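(* Let $\mathcal{A}_{jk}=\mathcal{A}_{kj}$ ($1\le j,k\le n$) be real constant $(m\times m)$-matrices such that the operator $$\mathfrak{A}_0(D_x)\boldsymbol u=\sum_{j,k=1}^n\mathcal{A}_{jk}\frac{\partial^2\boldsymbol u}{\partial x_j\partial x_k},\qquad\boldsymbol u=(u_1,\dots,u_m),$$ is strongly elliptic, and let $\alpha_1,\dots,\alpha_m\in\mathbb{R}$. The orthant $$\mathbf{R}^m_+(\alpha_1,\dots,\alpha_m)=\{u=(u_1,\dots,u_m):u_1\ge\alpha_1,\dots,u_m\ge\alpha_m\}$$ in $\mathbb{R}^m$ is invariant for the system $\mathfrak{A}_0(D_x)\boldsymbol u=\boldsymbol 0$ in the half-space $\mathbb{R}^n_+$ if and only if $$\mathfrak{A}_0(D_x)=A\,\mathrm{diag}\{L_1(D_x),\dots,L_m(D_x)\},$$ where $$L_i(D_x)=\sum_{j,k=1}^n a^{(i)}_{jk}\frac{\partial^2}{\partial x_j\partial x_k},\qquad i=1,\dots,m,$$ are scalar elliptic operators (with real constant coefficients) and $A$ is a non-degenerate real $(m\times m)$-matrix (not necessarily symmetric) such that the operator $A\,\mathrm{diag}\{L_1(D_x),\dots,L_m(D_x)\}$ is strongly elliptic.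
   Context: $\mathbb{R}^n_+=\{x=(x_1,\dots,x_n)\in\mathbb{R}^n:x_n>0\}$. Strong ellipticity of $\sum_{j,k}\mathcal{A}_{jk}\partial^2/\partial x_j\partial x_k$ means that there is $\delta>0$ with $\bigl(\sum_{j,k=1}^n\mathcal{A}_{jk}\sigma_j\sigma_k\boldsymbol\zeta,\boldsymbol\zeta\bigr)\ge\delta|\boldsymbol\sigma|^2|\boldsymbol\zeta|^2$ for all $\boldsymbol\sigma\in\mathbb{R}^n$, $\boldsymbol\zeta\in\mathbb{R}^m$, where $|\cdot|$ and $(\cdot,\cdot)$ are the Euclidean length and inner product. Invariance: a set $\mathcal{S}\subset\mathbb{R}^m$ is called invariant for a second-order elliptic system in a domain $\Omega$ if every bounded classical solution $\boldsymbol u=(u_1,\dots,u_m)$ of the system which is continuous in $\overline\Omega$ (that is, $\boldsymbol u\in C^2(\Omega;\mathbb{R}^m)\cap C_b(\overline\Omega;\mathbb{R}^m)$) and satisfies $\boldsymbol u(x)\in\mathcal{S}$ for all $x\in\partial\Omega$ takes values in $\mathcal{S}$ everywhere in $\Omega$. *)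

(* Defs.v *)
From HB Require Import structures.
From mathcomp Require Import all_boot all_order all_algebra.
From mathcomp Require Import all_classical all_reals all_analysis.

Set Implicit Arguments.
Unset Strict Implicit.
Unset Printing Implicit Defensive.

Import Order.TTheory GRing.Theory Num.Theory.
Import numFieldNormedType.Exports.

Local Open Scope classical_set_scope.
Local Open Scope ring_scope.

Section Defs.
Context {R : realType}.

Definition inner {m : nat} (x y : 'cV[R]_m) : R := \sum_(i < m) x i 0 * y i 0.

Definition enorm {m : nat} (x : 'cV[R]_m) : R := Num.sqrt (inner x x).

(* The last coordinate, written x_n in R^n, is ord_max in 'I_n.+1. *)
Definition half_space {n : nat} : set 'cV[R]_n.+1 := [set x | 0 < x ord_max 0].

Definition orthant {m : nat} (alpha : 'I_m -> R) : set 'cV[R]_m :=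
  [set u | forall i, alpha i <= u i 0].

Definition frontier {T : topologicalType} (Omega : set T) : set T :=
  closure Omega `\` Omega°.

Definition partial {n : nat} {V : normedModType R} (j : 'I_n)
    (f : 'cV[R]_n -> V) : 'cV[R]_n -> V :=
  fun x => 'D_(delta_mx j 0) f x.

(* f is C^1 (resp. C^2) on Omega, which is meant to be open: at its points
   continuity on Omega is then continuity in the ambient space. *)
Definition C1_on {n : nat} {V : normedModType R} (Omega : set 'cV[R]_n)
    (f : 'cV[R]_n -> V) : Prop :=
  forall x, Omega x ->
    {for x, continuous f} /\
    (forall j, derivable f x (delta_mx j 0) /\
               {for x, continuous (partial j f)}).

Definition C2_on {n : nat} {V : normedModType R} (Omega : set 'cV[R]_n)
    (f : 'cV[R]_n -> V) : Prop :=
  C1_on Omega f /\ forall j, C1_on Omega (partial j f).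

Definition Cb_closure {n : nat} {V : normedModType R} (Omega : set 'cV[R]_n)
    (f : 'cV[R]_n -> V) : Prop :=
  {within closure Omega, continuous f} /\
  [bounded f x | x in closure Omega].

Definition system_op {n m : nat} (Ac : 'I_n -> 'I_n -> 'M[R]_m)
    (u : 'cV[R]_n -> 'cV[R]_m) : 'cV[R]_n -> 'cV[R]_m :=
  fun x => \sum_(j < n) \sum_(k < n) Ac j k *m partial j (partial k u) x.

Definition scalar_op {n : nat} (a : 'I_n -> 'I_n -> R)
    (f : 'cV[R]_n -> R) : 'cV[R]_n -> R :=
  fun x => \sum_(j < n) \sum_(k < n)
    a j k * partial j (partial k f) x.

Definition diag_op {n m : nat} (a : 'I_m -> 'I_n -> 'I_n -> R)
    (u : 'cV[R]_n -> 'cV[R]_m) : 'cV[R]_n -> 'cV[R]_m :=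
  fun x => \col_(i < m) scalar_op (a i) (fun y => u y i 0) x.

(* The matrix coefficients of A diag(L_1, ..., L_m). *)
Definition mul_diag_coef {n m : nat} (A : 'M[R]_m)
    (a : 'I_m -> 'I_n -> 'I_n -> R) : 'I_n -> 'I_n -> 'M[R]_m :=
  fun j k => A *m diag_mx (\row_(i < m) a i j k).

Definition strongly_elliptic {n m : nat} (Ac : 'I_n -> 'I_n -> 'M[R]_m) : Prop :=
  exists2 delta : R, 0 < delta &
    forall (sigma : 'cV[R]_n) (zeta : 'cV[R]_m),
      delta * enorm sigma ^+ 2 * enorm zeta ^+ 2 <=
      inner ((\sum_(j < n) \sum_(k < n)
                (sigma j 0 * sigma k 0) *: Ac j k) *m zeta) zeta.

(* Ellipticity only asks that the symbol have no nonzero real root, so the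
   quadratic form of an elliptic operator may be negative definite. *)
Definition elliptic {n : nat} (a : 'I_n -> 'I_n -> R) : Prop :=
  forall sigma : 'cV[R]_n, sigma != 0 ->
    \sum_(j < n) \sum_(k < n) a j k * sigma j 0 * sigma k 0 != 0.

(* Equality of differential operators is equality of their actions on
   C^2 functions. *)
Definition eq_op_C2 {n m : nat}
    (P Q : ('cV[R]_n -> 'cV[R]_m) -> 'cV[R]_n -> 'cV[R]_m) : Prop :=
  forall u, C2_on setT u -> forall x, P u x = Q u x.

Definition invariant_for {n m : nat} (S : set 'cV[R]_m)
    (P : ('cV[R]_n -> 'cV[R]_m) -> 'cV[R]_n -> 'cV[R]_m)
    (Omega : set 'cV[R]_n) : Prop :=
  forall u : 'cV[R]_n -> 'cV[R]_m,
    C2_on Omega u -> Cb_closure Omega u ->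
    (forall x, Omega x -> P u x = 0) ->
    (forall x, frontier Omega x -> S (u x)) ->
    forall x, Omega x -> S (u x).

End Defs.

(* Main.v *)
(* If the system is [A diag (L_1, ..., L_m)], every component of a solution solves a
   scalar elliptic equation, and a quadratic barrier on large boxes gives the
   maximum principle for bounded functions in the half-space.

   Conversely, let [T] be the coefficient of the second normal derivative and test
   invariance on oscillating solutions [Re (exp (i s.x) V (x_n))], where [V] is a
   decaying exponential, possibly with a Jordan factor.  If [V_i] vanishes on the
   boundary then [V_i] vanishes identically: the other components can be lifted by
   constants, and both [V] and [-V] are admissible.  Hence the companion matrix of
   the symbol has no Jordan block, and its decaying solutions satisfy
   [V_i'(0) = i l_i V_i(0)].  As growing solutions are conjugate to decaying ones,
   the latter have dimension [m]; so each basis vector [e_i] is a null vector of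
   [l_i^2 + l_i q + p] with [q], [p] real and [l_i] not real, which makes [p] and
   [q] diagonal.  Here [p = T^-1 A(s)], so all [T^-1 A_jk] are diagonal by
   polarization. *)

From mathcomp Require Import all_boot all_order all_algebra.
From mathcomp Require Import all_classical all_reals all_analysis.
From mathcomp Require Import complex ring lra.
Require Import Defs.

Set Implicit Arguments.
Unset Strict Implicit.
Unset Printing Implicit Defensive.
Import Order.TTheory GRing.Theory Num.Theory.
Import numFieldNormedType.Exports.
Local Open Scope classical_set_scope.
Local Open Scope ring_scope.

(** * The matrix pencil of the boundary modes *)

Section Algebra.

(** The hypothesis lets every repeated root of the minimal polynomial be dropped, so the product of
    its distinct linear factors still annihilates [A]. *)
Lemma diagonalizable_no_jordan (F : closedFieldType) (n : nat) (A : 'M[F]_n.+1) :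
    (forall r (w : 'rV[F]_n.+1),
      w *m (A - r%:M) *m (A - r%:M) = 0 -> w *m (A - r%:M) = 0) ->
  diagonalizable A.
Proof.
move=> noJ; have [rs] := closed_field_poly_normal (mxminpoly A).
rewrite (eqP (mxminpoly_monic A)) scale1r => mE.
apply/diagonalizableP; exists (undup rs); first exact: undup_uniq.
apply/mxminpoly_min.
have hXC z : horner_mx A ('X - z%:P) = A - z%:M.
  by rewrite rmorphB /= horner_mx_X horner_mx_C.
have noJm r (B : 'M[F]_n.+1) :
    B *m (A - r%:M) *m (A - r%:M) = 0 -> B *m (A - r%:M) = 0.
  move=> B0; apply/row_matrixP => i; rewrite row0 row_mul; apply: noJ.
  by rewrite -!row_mul B0 row0.
(* Since [B] is arbitrary, a factor met for the last time is absorbed into it. A factor that occurs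
   again is commuted next to its other copy, and [noJm] drops one of the two. *)
have cut (s : seq F) : forall B : 'M[F]_n.+1,
    B *m horner_mx A (\prod_(z <- s) ('X - z%:P)) = 0 ->
    B *m horner_mx A (\prod_(z <- undup s) ('X - z%:P)) = 0.
  elim: s => [//|x s IH] B /=.
  rewrite big_cons rmorphM /= hXC mulmxA => /IH {IH}.
  case: ifPn => xs; last by rewrite big_cons rmorphM /= hXC mulmxA.
  have xu : x \in undup s by rewrite mem_undup.
  rewrite (perm_big _ (perm_to_rem xu)) /= big_cons.
  rewrite [('X - _) * _]mulrC rmorphM /= hXC.
  set Z := horner_mx A _ => B0.
  have ZA : Z *m (A - x%:M) = (A - x%:M) *m Z.
    by rewrite -hXC -[LHS]rmorphM mulrC rmorphM.
  rewrite mulmxA; apply: noJm.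
by rewrite -(mulmxA B) ZA mulmxA -(mulmxA _ Z).
by have := cut rs 1%:M; rewrite !mul1mx; apply; rewrite -mE mx_root_minpoly.
Qed.

End Algebra.

Section Pencil.
Variables (R : rcfType) (m : nat) (P Q : 'M[R]_m.+1).
Local Notation C := R[i].
Local Notation cx := (map_mx (real_complex R)).

(* Everything is transposed: vectors are rows and [P], [Q] act on the right. *)
Definition pencil (r : C) : 'M[C]_m.+1 := (r ^+ 2)%:M + r *: cx Q + cx P.

(* Equivalently, [exp (i r t) (a + i t b)] solves [V'' + i V' Q - V P = 0]. *)
Definition jordan_pair (r : C) (a b : 'rV[C]_m.+1) :=
  b *m pencil r = 0 /\ a *m pencil r + b *m ((2 * r)%:M + cx Q) = 0.

(** First-order form of the equation: with [c = - i V'] and [w = (V, c)] it reads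
    [w' = i w companion]. *)
Definition companion : 'M[C]_(m.+1 + m.+1) :=
  block_mx 0 (- cx P) 1%:M (- cx Q).

Lemma mul_companion_sub (r : C) (a c : 'rV[C]_m.+1) :
  row_mx a c *m (companion - r%:M) =
  row_mx (c - r *: a) (- (a *m cx P) - c *m cx Q - r *: c).
Proof.
rewrite mulmxBr mul_mx_scalar mul_row_block mulmx0 mulmx1 add0r !mulmxN.
by rewrite scale_row_mx opp_row_mx add_row_mx.
Qed.

Lemma companion_eigenP (r : C) (a c : 'rV[C]_m.+1) :
  row_mx a c *m (companion - r%:M) = 0 -> c = r *: a /\ a *m pencil r = 0.
Proof.
rewrite mul_companion_sub -row_mx0 => /eq_row_mx[/subr0_eq-> e2]; split=> //.
rewrite /pencil !mulmxDr mul_mx_scalar -scalemxAr -scalemxAl in e2 *.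
move: (a *m cx P) (a *m cx Q) e2 => u v /rowP e2; apply/rowP => i.
by have := e2 i; rewrite !mxE => /eqP; rewrite -oppr_eq0 => /eqP <-; ring.
Qed.

(** Applying [companion - r] once leaves a true eigenvector, whose left block is [c - r a]; this
    block is the coefficient of the Jordan factor. *)
Lemma companion_jordanP (r : C) (a c : 'rV[C]_m.+1) :
    row_mx a c *m (companion - r%:M) *m (companion - r%:M) = 0 ->
  jordan_pair r a (c - r *: a).
Proof.
rewrite mul_companion_sub => /companion_eigenP[].
set b := c - r *: a => e1 e2; split=> //.
have ec : c = b + r *: a by rewrite /b subrK.
rewrite /pencil !mulmxDr !mul_mx_scalar -!scalemxAr.
have : - (a *m cx P) - c *m cx Q - r *: c - r *: b = 0 by rewrite e1 subrr.
rewrite ec mulmxDl -scalemxAl.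
move: (a *m cx P) (a *m cx Q) (b *m cx Q) => u v w /rowP e; apply/rowP => i.
by have := e i; rewrite !mxE => /eqP; rewrite -oppr_eq0 => /eqP <-; ring.
Qed.

Lemma pencil_kernelP (r : C) (a : 'rV[C]_m.+1) :
  a *m pencil r = 0 -> jordan_pair r a 0.
Proof. by move=> a0; split; rewrite ?mul0mx ?addr0. Qed.

Lemma conj_companion_sub (r : C) :
  map_mx conjc (companion - r%:M) = companion - (r^*)%C%:M.
Proof.
have cR (A : 'M[R]_m.+1) : map_mx conjc (cx A) = cx A.
  by apply/matrixP => i j; rewrite !mxE conjc_real.
rewrite map_mxB map_scalar_mx /companion map_block_mx !map_mxN !cR.
by rewrite raddf0 map_mx1.
Qed.

Hypothesis regular : forall t : R, (t ^+ 2)%:M + t *: Q + P \in unitmx.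

Lemma companion_real_eigen (r : C) (w : 'rV[C]_(m.+1 + m.+1)) :
  complex.Im r = 0 -> w *m (companion - r%:M) = 0 -> w = 0.
Proof.
case: r => t _ /= ->; rewrite -[w]hsubmxK.
case/companion_eigenP => -> /eqP a0.
have pE : pencil (t +i* 0)%C = cx ((t ^+ 2)%:M + t *: Q + P).
  by rewrite /pencil !map_mxD map_mxZ map_scalar_mx (rmorphXn (real_complex R)).
have u : pencil (t +i* 0)%C \in unitmx by rewrite pE map_unitmx.
have -> : lsubmx w = 0 by rewrite -[lsubmx w](mulmxK u) (eqP a0) mul0mx.
by rewrite scaler0 row_mx0.
Qed.

(* For bounded solutions [V] built from at most two eigenvalues, the vanishing
   of a component of [V 0] forces that of the same component of [V' 0]. *)
Hypothesis rigid : forall (r1 r2 : C) (a1 b1 a2 b2 : 'rV[C]_m.+1),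
  0 < complex.Im r1 -> 0 < complex.Im r2 ->
  jordan_pair r1 a1 b1 -> jordan_pair r2 a2 b2 ->
  forall i, a1 0 i + a2 0 i = 0 ->
    r1 * a1 0 i + b1 0 i + (r2 * a2 0 i + b2 0 i) = 0.

(** If [b] had a nonzero [i]-th entry, a multiple of the pure exponential [b] could be subtracted to
    cancel the [i]-th entry of [a]. The derivative would keep the entry of [b], against [rigid]. *)
Lemma upper_jordan_pair (r : C) (a b : 'rV[C]_m.+1) :
  0 < complex.Im r -> jordan_pair r a b -> b = 0.
Proof.
move=> r0 J; apply/rowP => i; rewrite [RHS]mxE; apply/eqP/negPn/negP => bi0.
have K : jordan_pair r ((- (a 0 i / b 0 i)) *: b) 0.
  by apply: pencil_kernelP; rewrite -scalemxAl (proj1 J) scaler0.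
have := rigid r0 r0 J K (i := i); rewrite !mxE mulNr divfK // subrr => /(_ erefl).
by rewrite addr0 mulrN addrAC subrr add0r => /eqP; rewrite (negPf bi0).
Qed.

(** Jordan blocks are excluded in the upper half-plane by [upper_jordan_pair], in the lower one by
    conjugation, and on the real axis because there are no eigenvalues. *)
Lemma companion_diagonalizable : diagonalizable companion.
Proof.
have upper (r : C) (w : 'rV[C]_(m.+1 + m.+1)) : 0 < complex.Im r ->
    w *m (companion - r%:M) *m (companion - r%:M) = 0 ->
    w *m (companion - r%:M) = 0.
  move=> r0; rewrite -[w]hsubmxK => /[dup] J /companion_jordanP/(upper_jordan_pair r0).
  move: J; rewrite mul_companion_sub => /companion_eigenP[-> _] ->.
  by rewrite scaler0 row_mx0.
apply: (@diagonalizable_no_jordan _ (m + m.+1)) => r w J.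
have [r0|r0|r0] := ltgtP (complex.Im r) 0.
- have s0 : 0 < complex.Im (r^*)%C by case: (r) r0 => x y /=; rewrite oppr_gt0.
  apply: (@map_mx_inj _ _ (@conjc R)); rewrite map_mxM conj_companion_sub map_mx0.
  apply: upper => //.
  by rewrite -conj_companion_sub -!map_mxM J map_mx0.
- exact: upper.
- exact: (companion_real_eigen r0 J).
Qed.

(** Two decaying exponentials with nonzero [i]-th entries can be combined so that these entries
    cancel at [0]; [rigid] then equates their exponents. *)
Lemma upper_eigenvalues : exists l : 'I_m.+1 -> C, forall i,
  0 < complex.Im (l i) /\
  forall (r : C) (a : 'rV[C]_m.+1), 0 < complex.Im r -> a *m pencil r = 0 ->
    r * a 0 i = l i * a 0 i.
Proof.
suff ex (i : 'I_m.+1) : exists l : C, 0 < complex.Im l /\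
    forall (r : C) (a : 'rV[C]_m.+1), 0 < complex.Im r -> a *m pencil r = 0 ->
      r * a 0 i = l * a 0 i.
  by have [l lP] := choice ex; exists l.
have [[r0 [a0 [r0p [a0k a0i]]]]|no] := pselect (exists (r : C) (a : 'rV[C]_m.+1),
    0 < complex.Im r /\ (a *m pencil r = 0 /\ a 0 i != 0)); last first.
  (* Here every decaying exponential vanishes in component [i], and any value in the upper
     half-plane serves. *)
  exists 'i%C; split=> [|r a rp ak]; first exact: ltr01.
  have [->|ai] := eqVneq (a 0 i) 0; first by rewrite !mulr0.
  by exfalso; apply: no; exists r, a.
exists r0; split=> // r a rp ak.
have K : jordan_pair r0 ((- (a 0 i / a0 0 i)) *: a0) 0.
  by apply: pencil_kernelP; rewrite -scalemxAl a0k scaler0.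
have := rigid rp r0p (pencil_kernelP ak) K (i := i).
rewrite !mxE mulNr divfK // subrr => /(_ erefl).
by rewrite !addr0 mulrN => /subr0_eq.
Qed.

(* The decaying solutions lie in [X], where [V' 0 = i V 0 D]; the growing ones
   are their complex conjugates, so a dimension count makes [X] invariant, that
   is [D ^ 2 + D Q + P = 0] with [D] diagonal and no entry of [D] real. *)
Lemma pencil_diagonal (i j : 'I_m.+1) : i != j -> P i j = 0 /\ Q i j = 0.
Proof.
have [l lP] := upper_eigenvalues.
pose D : 'M[C]_m.+1 := diag_mx (\row_i l i).
pose X : 'M[C]_(m.+1, m.+1 + m.+1) := row_mx 1%:M D.
pose X' : 'M[C]_(m.+1, m.+1 + m.+1) := map_mx conjc X.
have upX (w : 'rV[C]_(m.+1 + m.+1)) (r : C) : 0 < complex.Im r ->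
    w *m (companion - r%:M) = 0 -> (w <= X)%MS.
  move=> r0; rewrite -[w]hsubmxK => /companion_eigenP[-> ak].
  apply/submxP; exists (lsubmx w); rewrite mul_mx_row mulmx1; congr row_mx.
  apply/rowP => k; rewrite mul_mx_diag !mxE [RHS]mulrC.
  by have [_ /(_ r _ r0 ak)] := lP k; rewrite !mxE.
have eigX (r : C) : 0 < complex.Im r -> (eigenspace companion r <= X)%MS.
  move=> r0; apply/row_subP => k; apply: (upX _ r) => //.
  by apply/sub_kermxP; exact: row_sub.
have eigX' (r : C) : complex.Im r < 0 -> (eigenspace companion r <= X')%MS.
  move=> r0; have s0 : 0 < complex.Im (r^*)%C by case: (r) r0 => x y /=; rewrite oppr_gt0.
  apply/row_subP => k; rewrite -(map_submx (@conjc R)) -map_mx_comp.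
  rewrite [X in (_ <= X)%MS](_ : _ = X); last first.
    by apply/matrixP => x y; rewrite !mxE /= conjcK.
  apply: (upX _ _ s0); rewrite -conj_companion_sub -map_mxM.
  by rewrite (sub_kermxP _) ?map_mx0 //; exact: row_sub.
have /diagonalizablePeigen[rs _ rsE] := companion_diagonalizable.
pose E : 'M[C]_(m.+1 + m.+1) :=
  (\sum_(r <- rs | (0 < complex.Im r)%R) eigenspace companion r)%MS.
have EX : (E <= X)%MS.
  rewrite /E; elim/big_ind: _ => [|A B AX BX|r]; first exact: sub0mx.
    by rewrite addsmx_sub AX.
  exact: eigX.
have full : (1%:M <= E + X')%MS.
  rewrite -(rsE) (bigID (fun r => (0 < complex.Im r)%R)) /=; apply: addsmxS => //.
  elim/big_ind: _ => [|A B AX BX|r]; first exact: sub0mx.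
    by rewrite addsmx_sub AX.
  rewrite -leNgt le_eqVlt => /predU1P[r0|]; last exact: eigX'.
  suff -> : eigenspace companion r = 0 by exact: sub0mx.
  apply/row_matrixP => k; rewrite row0; apply: (companion_real_eigen r0).
  by apply/sub_kermxP; exact: row_sub.
(* [E] and [X'] together span dimension [2 (m + 1)] and [X'] has rank at most [m + 1], so [E] has
   rank at least that of [X]. *)
have XE : (X <= E)%MS.
  rewrite -(geq_leqif (mxrank_leqif_sup EX)).
  have := leq_trans (mxrankS full) (mxrank_adds_leqif E X').1.
  rewrite mxrank1 => h; rewrite (leq_trans (rank_leq_row _)) //.
  by rewrite -(leq_add2r m.+1) (leq_trans h) // leq_add2l rank_leq_row.
have stabE : stablemx E companion.
  rewrite /E; elim/big_ind: _ => [|A B AX BX|r _]; first exact: stable0mx.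
    by rewrite addsmxMr; exact: addsmxS.
  by rewrite (eigenspaceP (submx_refl _)) scalemx_sub.
have /submxP[Y] : (X *m companion <= X)%MS.
  exact: submx_trans (submxMr _ XE) (submx_trans stabE EX).
(* The left blocks give [Y = D], the right ones [- P - D Q = D D]. Off the diagonal this says
   [P i j + l i Q i j = 0], where [l i] is not real. *)
rewrite mul_row_block mulmx0 mulmx1 mul1mx add0r mul_mx_row mulmx1 mulmxN.
case/eq_row_mx => <- /matrixP/(_ i j) e ij; move: e.
rewrite !mul_diag_mx !mxE (negPf ij) mulr0n mulr0 => /eqP.
have [+ _] := lP i; case: (l i) => x y /= y0.
rewrite eq_complex /= => /andP[/eqP e1 /eqP e2].
have Qij : Q i j = 0.
  have : y * Q i j = 0 by lra.
  by move/eqP; rewrite mulf_eq0 gt_eqF //= => /eqP.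
by split=> //; move: e1; rewrite Qij; lra.
Qed.

End Pencil.

(** * Second-order conditions at a minimum *)

Section Calculus.
Variables (R : realType) (n : nat).
Implicit Types (f g : 'cV[R]_n -> R) (x y s e : 'cV[R]_n).

Lemma is_derive_line f y e (t : R) : derivable f (t *: e + y) e ->
  is_derive t 1 (fun t : R => f (t *: e + y)) ('D_e f (t *: e + y)).
Proof.
move=> df.
have E : (fun h : R => h^-1 *: (((fun t : R => f (t *: e + y)) \o shift t) (h *: 1)
            - f (t *: e + y))) =
    (fun h : R => h^-1 *: ((f \o shift (t *: e + y)) (h *: e) - f (t *: e + y))).
  by apply/funext => h /=; rewrite [h *: 1]mulr1 scalerDl addrA.
by apply: DeriveDef; rewrite /derivable /derive /= E.
Qed.

Lemma MVT_line f y e (t : R) : 0 < t ->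
    (forall r, 0 <= r <= t -> derivable f (r *: e + y) e) ->
  exists2 r, 0 < r < t & f (t *: e + y) - f y = t * 'D_e f (r *: e + y).
Proof.
move=> t0 df; pose F (r : R) := f (r *: e + y).
have dF r : r \in `]0, t[ -> is_derive r 1 F ('D_e f (r *: e + y)).
  by rewrite in_itv /= => /andP[r0 rt]; apply/is_derive_line/df; rewrite !ltW.
have cF : {within `[0, t], continuous F}.
  apply: derivable_within_continuous => r; rewrite in_itv /= => rt.
  by have [] := is_derive_line (df r rt).
have [r rt] := MVT t0 dF cF.
rewrite /F scale0r add0r subr0 => E; exists r; last by rewrite E mulrC.
by move: rt; rewrite in_itv.
Qed.

Lemma MVT_line_sym f y e (t : R) :
    (forall r, `|r| <= `|t| -> derivable f (r *: e + y) e) ->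
  exists2 r, `|r| <= `|t| & f (t *: e + y) - f y = t * 'D_e f (r *: e + y).
Proof.
move=> df; have [t0|t0|<-] := ltgtP 0 t; last first.
- by exists 0; rewrite // scale0r add0r subrr mul0r.
- have Nt0 : 0 < - t by rewrite oppr_gt0.
  have [r /andP[r0 rt]|r /andP[r0 rt]] := @MVT_line f (t *: e + y) e (- t) Nt0.
    rewrite addrA -scalerDl; apply: df.
    by rewrite (ltr0_norm t0) ler_norml; lra.
  rewrite addrA -scalerDl addNr scale0r add0r => E; exists (r + t).
    by rewrite (ltr0_norm t0) ler_norml; lra.
  by move: E; rewrite addrA -scalerDl; lra.
- have [r rt|r /andP[r0 rt] E] := @MVT_line f y e t t0.
    by apply: df; rewrite (gtr0_norm t0) ler_norml; lra.
  by exists r; rewrite // (gtr0_norm t0) ler_norml; lra.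
Qed.

(** The increment splits into one along [s] from [x] and one along [e] from [x + h s]; the mean
    value theorem turns the latter into a value of ['D_e f] close to [x]. *)
Lemma is_deriveD_dir f x s e (c : R) : derivable f x s ->
    (\forall y \near x, derivable f y e) -> {for x, continuous ('D_e f)} ->
  is_derive x (s + c *: e) f ('D_s f x + c * 'D_e f x).
Proof.
move=> ds de ce.
pose q (h : R) := h^-1 *: (f (h *: (s + c *: e) + x) - f (h *: s + x)).
suff q_cvg : q h @[h --> 0^'] --> c * 'D_e f x.
  have E : (h^-1 *: ((f \o shift x) (h *: (s + c *: e)) - f x)) @[h --> 0^'] -->
      'D_s f x + c * 'D_e f x.
    apply: (cvg_trans _ (cvgD ds q_cvg)); apply: near_eq_cvg; near=> h.
    by rewrite /q /= !fctE /= -scalerDr [X in _ *: X]addrC addrA subrK.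
  by apply: DeriveDef; [exact: cvgP E|exact: cvg_lim E].
apply/cvgrPdist_le => eps eps0.
pose eps' := eps / (`|c| + 1).
have eps'0 : 0 < eps' by rewrite divr_gt0 // ltr_wpDl.
have : \forall y \near x, derivable f y e /\ `|'D_e f x - 'D_e f y| <= eps'.
  near=> y; split; first by near: y.
  by near: y; move/cvgrPdist_le: ce; apply.
move=> /nbhs_ballP[r /= r0 rP].
(* [k] exceeds the displacement per unit of [h], so [|h| < r / k] keeps the mean value segment
   inside the ball of radius [r]. *)
pose k := `|s| + `|c| * `|e| + 1.
have k0 : 0 < k by rewrite ltr_wpDl // addr_ge0 // mulr_ge0.
near=> h.
have h0 : h != 0 by near: h; exact: nbhs_dnbhs_neq.
have hr : `|h| < r / k.
  by near: h; apply: dnbhs0_lt; rewrite divr_gt0.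
have inb t : `|t| <= `|h * c| -> ball x r (t *: e + (h *: s + x)).
  move=> tl; rewrite -ball_normE /ball_ /= addrA opprD addrCA subrr addr0 normrN.
  rewrite (le_lt_trans (ler_normD _ _)) // !normrZ.
  rewrite ltr_pdivlMr // in hr; apply: le_lt_trans hr.
  rewrite normrM in tl; rewrite /k !mulrDr mulr1 mulrA.
  rewrite (le_trans (lerD (ler_wpM2r _ tl) (lexx _))) //.
  by rewrite addrC lerDl.
have [t tl E] := @MVT_line_sym f (h *: s + x) e (h * c) (fun t tl => (rP _ (inb t tl)).1).
rewrite /q (scalerDr h s) [h *: s + h *: (c *: e)]addrC (scalerA h c) -(addrA _ (h *: s) x) E.
rewrite scalerAl [_ *: (_ * _)]mulrA mulVf // mul1r -mulrBr normrM.
have [_ D] := rP _ (inb t tl).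
rewrite (le_trans (ler_wpM2l _ D)) // /eps' mulrA ler_pdivrMr ?ltr_wpDl //.
by rewrite mulrDr mulr1 mulrC lerDl ltW.
Unshelve. all: by end_near. Qed.

Lemma is_derive_C1 (Omega : set 'cV[R]_n) f x s :
  open Omega -> C1_on Omega f -> Omega x ->
  is_derive x s f (\sum_(j < n) s j 0 * partial j f x).
Proof.
move=> oO fC1 Ox.
have nO : \forall y \near x, Omega y by exact: open_nbhs_nbhs.
have E (r : seq 'I_n) : is_derive x (\sum_(j <- r) s j 0 *: delta_mx j 0) f
    (\sum_(j <- r) s j 0 * partial j f x).
  elim: r => [|j r IH]; first by rewrite !big_nil; exact: is_derive0.
  rewrite !big_cons addrC [X in is_derive _ _ _ X]addrC.
  have [d <-] := IH.
  have ej : \forall y \near x, derivable f y (delta_mx j 0).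
    by apply: filterS nO => y /fC1[_ /(_ j)[]].
  have [_ /(_ j)[_ cj]] := fC1 x Ox.
  exact: (is_deriveD_dir _ d ej cj).
have sE : s = \sum_j s j 0 *: delta_mx j 0.
  by rewrite {1}[s]matrix_sum_delta; apply: eq_bigr => j _; rewrite big_ord1.
by rewrite {1}sE; exact: E.
Qed.

(** A negative Hessian form would make the slope along [s] decrease at [x]. A slope that is
    nonpositive at [x] is then negative just beyond it, and the mean value theorem yields values
    below [f x]. *)
Lemma local_min_hessian (Omega : set 'cV[R]_n) f x s :
    open Omega -> C2_on Omega f -> Omega x -> (\forall y \near x, f x <= f y) ->
  0 <= \sum_(j < n) \sum_(k < n) s j 0 * s k 0 * partial j (partial k f) x.
Proof.
move=> oO [fC1 fC2] Ox fmin; rewrite leNgt; apply/negP => H0.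
pose g s y := \sum_(k < n) s k 0 * partial k f y.
(* The Hessian form is even in [s] and the slope [g s x] is odd. *)
wlog gx : s H0 / g s x <= 0.
  move=> W; have [|gx] := leP (g s x) 0; first exact: W.
  apply: (W (- s)).
    under eq_bigr do under eq_bigr do rewrite !mxE mulrNN.
    exact: H0.
  rewrite /g; under eq_bigr do rewrite mxE mulNr.
  by rewrite sumrN oppr_le0 ltW.
have nO : \forall y \near x, Omega y by exact: open_nbhs_nbhs.
have dg : is_derive x s (g s)
    (\sum_(j < n) \sum_(k < n) s j 0 * s k 0 * partial j (partial k f) x).
  have -> : g s = \sum_(k < n) (fun y => s k 0 *: partial k f y).
    by apply/funext => y; rewrite fct_sumE.
  apply: is_derive_eq.
    apply: is_derive_sum => k; apply: is_deriveZ; exact: (is_derive_C1 s oO (fC2 k) Ox).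
  under eq_bigr do rewrite scaler_sumr.
  rewrite exchange_big; apply: eq_bigr => j _; apply: eq_bigr => k _.
  by rewrite [_ *: _]mulrCA mulrA.
have [dv Hv] := dg.
have : \forall h \near 0^', h^-1 *: ((g s \o shift x) (h *: s) - g s x) < 0.
  by apply: (cvgr_lt _ dv); move: H0; rewrite -Hv.
rewrite near_withinE => /nbhs_ballP[r1 /= r10 P1].
have : \forall t \near (0 : R), f x <= f (t *: s + x) /\ Omega (t *: s + x).
  have ct : (t *: s + x) @[t --> (0 : R)] --> x.
    have := cvgD (cvgZ (@cvg_id _ (nbhs (0 : R))) (cvg_cst s)) (cvg_cst x).
    by rewrite scale0r add0r; apply.
  have nb : nbhs x [set y | f x <= f y /\ Omega y] by exact: filterI.
  exact: (ct _ nb).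
move=> /nbhs_ballP[r2 /= r20 P2].
pose t := Num.min r1 r2 / 2.
have m0 : 0 < Num.min r1 r2 by rewrite lt_min r10.
have t0 : 0 < t by rewrite divr_gt0.
have [t1 t2] : t < r1 /\ t < r2.
  by apply/andP; rewrite -lt_min /t; lra.
have inb2 u : 0 <= u <= t -> ball (0 : R) r2 u.
  by move=> ut; rewrite -ball_normE /ball_ /= sub0r normrN ger0_norm; lra.
have [u ut|u /andP[u0 ut] E] := @MVT_line f x s t t0.
  by have [] := is_derive_C1 s oO fC1 (P2 _ (inb2 _ ut)).2.
have Ou : Omega (u *: s + x) by apply: (P2 _ (inb2 _ _)).2; rewrite !ltW.
have := (P2 t (inb2 t _)).1; rewrite lexx ltW // => /(_ isT); rewrite -subr_ge0 E.
have [_ ->] := is_derive_C1 s oO fC1 Ou.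
rewrite pmulr_rge0 // -/(g s (u *: s + x)) leNgt => /negP; apply.
have /(_ _)/= := P1 u; rewrite -ball_normE /ball_ /= sub0r normrN gtr0_norm //.
move=> /(_ (lt_trans ut t1) (lt0r_neq0 u0)).
by rewrite pmulr_rlt0 ?invr_gt0 // subr_lt0 => /lt_le_trans; apply.
Unshelve. all: by end_near. Qed.

End Calculus.

(** * Semidefinite and definite quadratic forms *)

Section Psd.
Variables (R : realFieldType) (n : nat).
Implicit Types (b H : 'I_n -> 'I_n -> R) (x : 'I_n -> R).

Definition quad b x := \sum_(j < n) \sum_(k < n) b j k * x j * x k.

Lemma quad_sub b x (i : 'I_n) (l : R) : (forall j k, b j k = b k j) ->
  quad b (fun j => x j - l * (j == i)%:R) =
  quad b x - 2 * l * (\sum_(k < n) x k * b i k) + l ^+ 2 * b i i.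
Proof.
move=> bsym.
have S g : \sum_(j < n) (x j - l * (j == i)%:R) * g j =
    \sum_(j < n) x j * g j - l * g i.
  under eq_bigr do rewrite mulrBl; rewrite sumrB; congr (_ - _).
  rewrite (bigD1 i) //= eqxx mulr1 big1 ?addr0 // => j /negPf ->.
  by rewrite mulr0 mul0r.
have quadE y : quad b y = \sum_(j < n) y j * \sum_(k < n) y k * b j k.
  apply: eq_bigr => j _; rewrite mulr_sumr; apply: eq_bigr => k _; ring.
rewrite !quadE S S; under eq_bigr do rewrite S mulrBr.
rewrite sumrB.
have -> : \sum_(j < n) x j * (l * b j i) = l * \sum_(k < n) x k * b i k.
  by rewrite mulr_sumr; apply: eq_bigr => k _; rewrite bsym; ring.
by ring.
Qed.

(** When [b i i = 0], the form is affine along the [i]-th axis; starting from the [j]-th basis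
    vector its slope is proportional to [b i j], so it would become negative. *)
Lemma psd_diag0 b (i j : 'I_n) : (forall j k, b j k = b k j) ->
  (forall x, 0 <= quad b x) -> b i i = 0 -> b i j = 0.
Proof.
move=> bsym psd bii; apply/eqP/negPn/negP => bij.
pose x (k : 'I_n) : R := (k == j)%:R.
have bx : \sum_(k < n) x k * b i k = b i j.
  rewrite (bigD1 j) //= /x eqxx mul1r big1 ?addr0 // => k /negPf ->.
  by rewrite mul0r.
(* The multiple of the [i]-th basis vector is chosen so that the form takes the value [-1]. *)
have := psd (fun k => x k - (quad b x + 1) / (2 * b i j) * (k == i)%:R).
rewrite quad_sub // bx bii mulr0 addr0.
have -> : 2 * ((quad b x + 1) / (2 * b i j)) * b i j = quad b x + 1 by field.
by rewrite opprD addrA subrr add0r oppr_ge0 ler10.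
Qed.

(* Subtracting the rank-one form [(b i _)^2 / b i i] clears row [i] and keeps
   [b] semidefinite. *)
Lemma psd_contraction_ge0 b H : (forall j k, b j k = b k j) ->
    (forall x, 0 <= quad b x) -> (forall x, 0 <= quad H x) ->
  0 <= \sum_(j < n) \sum_(k < n) b j k * H j k.
Proof.
move=> bsym psd Hpsd.
(* Induction on [m], where only the first [m] rows of [b] may be nonzero. *)
suff ind m : forall b, (forall j k, b j k = b k j) -> (forall x, 0 <= quad b x) ->
    (forall i j : 'I_n, (m <= i)%N -> b i j = 0) ->
    0 <= \sum_(j < n) \sum_(k < n) b j k * H j k.
  by apply: (ind n) => // i j; rewrite leqNgt ltn_ord.
elim: m => [|m IH] {bsym psd}b bsym psd b0.
  by rewrite big1 // => j _; rewrite big1 // => k _; rewrite b0 // mul0r.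
have [nm|mn] := leqP n m.
  by apply: IH => // i j mi; have := ltn_ord i; rewrite ltnNge (leq_trans nm mi).
pose i := Ordinal mn.
have step : forall j k : 'I_n, (m <= j)%N -> j != i -> b j k = 0.
  by move=> j k mj ji; apply: b0; rewrite ltn_neqAle mj eq_sym andbT.
have [bii|bii] := eqVneq (b i i) 0.
  apply: IH => // j k mj; have [->|ji] := eqVneq j i; first exact: psd_diag0.
  exact: step.
have bpos : 0 < b i i.
  rewrite lt_neqAle eq_sym bii /=; pose x (k : 'I_n) : R := 0.
  have := psd (fun k => x k - (-1) * (k == i)%:R); rewrite quad_sub //.
  have -> : quad b x = 0.
    by apply: big1 => j _; apply: big1 => k _; rewrite mulr0.
  by rewrite big1 => [|k _]; rewrite ?mul0r //; lra.
pose b' j k := b j k - b i j * b i k / b i i.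
(* Completing the square: [b'] at [x] is [b] at [x] shifted along the [i]-th axis, hence
   nonnegative. *)
have qb' x : quad b' x = quad b (fun j => x j - (\sum_(k < n) x k * b i k) / b i i * (j == i)%:R).
  rewrite quad_sub //; set S := \sum_(k < n) _.
  have -> : quad b' x = quad b x - S ^+ 2 / b i i.
    rewrite expr2 [X in X / _](_ : _ = \sum_j \sum_k (x j * b i j) * (x k * b i k)).
      rewrite mulr_suml -sumrB; apply: eq_bigr => j _.
      rewrite mulr_suml -sumrB; apply: eq_bigr => k _; rewrite /b'; ring.
    by rewrite mulr_suml; apply: eq_bigr => j _; rewrite mulr_sumr.
  by field.
have b'0 : 0 <= \sum_(j < n) \sum_(k < n) b' j k * H j k.
  apply: IH => [j k|x|j k mj]; first by rewrite /b' bsym; ring.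
    by rewrite qb'.
  rewrite /b'; have [->|ji] := eqVneq j i; first by field.
  by rewrite step // bsym step //; ring.
have -> : \sum_j \sum_k b j k * H j k = \sum_j \sum_k b' j k * H j k +
    quad H (fun j => b i j) / b i i.
  rewrite mulr_suml -big_split /=; apply: eq_bigr => j _.
  rewrite mulr_suml -big_split /=; apply: eq_bigr => k _; rewrite /b'; ring.
by rewrite addr_ge0 // divr_ge0 // ltW.
Qed.

End Psd.

(** If [b] is positive at [x] and negative at [y], the quadratic polynomial [t |-> quad b (x + t y)]
    has a real root. The vector at the root cannot be [0], since then [x] would be a multiple of [y]
    and the form nonpositive at [x]. *)
Lemma quad_definite (R : rcfType) n (b : 'I_n -> 'I_n -> R) :
  (forall x, (exists i, x i != 0) -> quad b x != 0) ->
  (forall x, (exists i, x i != 0) -> 0 < quad b x) \/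
  (forall x, (exists i, x i != 0) -> quad b x < 0).
Proof.
move=> ell; apply: contrapT => /not_orP[/existsNP[y yP] /existsNP[x xP]].
have [y0 qy] : (exists i, y i != 0) /\ quad b y < 0.
  have /not_implyP[y0 /negP] := yP.
  by rewrite -leNgt le_eqVlt (negPf (ell _ y0)).
have [x0 qx] : (exists i, x i != 0) /\ 0 < quad b x.
  have /not_implyP[x0 /negP] := xP.
  by rewrite -leNgt le_eqVlt eq_sym (negPf (ell _ x0)).
pose B := \sum_(j < n) \sum_(k < n) b j k * (x j * y k + y j * x k).
have qE t : quad b (fun j => x j + t * y j) = quad b x + t * B + t ^+ 2 * quad b y.
  rewrite /quad /B !mulr_sumr -!big_split /=; apply: eq_bigr => j _.
  rewrite !mulr_sumr -!big_split /=; apply: eq_bigr => k _; ring.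
pose D := B ^+ 2 - 4 * quad b x * quad b y.
have D0 : 0 <= D by rewrite subr_ge0 (le_trans _ (sqr_ge0 B)) // nmulr_lle0 // ltW // mulr_gt0.
pose t := (- B + Num.sqrt D) / (2 * quad b y).
have root : quad b (fun j => x j + t * y j) = 0.
  have := sqr_sqrtr D0; rewrite qE /t; move: (Num.sqrt D) => r.
  have qy0 : quad b y != 0 by rewrite lt_eqF.
  rewrite /D => rE; apply: (mulIf qy0); rewrite mul0r.
  transitivity ((r ^+ 2 - (B ^+ 2 - 4 * quad b x * quad b y)) / 4); first by field.
  by rewrite rE subrr mul0r.
have [[i ti]|/forallNP no] := pselect (exists i, x i + t * y i != 0).
  have := ell (fun j => x j + t * y j); rewrite root eqxx.
  by move=> /(_ (ex_intro _ i ti)).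
have xE : x = (fun j => 0 + - t * y j).
  apply/funext => i; have /negP := no i; rewrite negbK => /eqP; lra.
move: qx; rewrite xE /quad.
have -> : \sum_(j < n) \sum_(k < n) b j k * (0 + - t * y j) * (0 + - t * y k) =
    t ^+ 2 * quad b y.
  rewrite mulr_sumr; apply: eq_bigr => j _; rewrite mulr_sumr; apply: eq_bigr => k _.
  ring.
by rewrite ltNge nmulr_lle0 // sqr_ge0.
Qed.

(** * Partial derivatives and C^2 functions *)

Section Partials.
Variables (R : realType) (n : nat).
Implicit Types (Omega : set 'cV[R]_n) (x s : 'cV[R]_n).

Lemma is_derive_coord (j : 'I_n) x s :
  is_derive x s (fun y : 'cV[R]_n => y j 0) (s j 0).
Proof.
have d : derivable (@id 'cV[R]_n) x s by exact: derivable_id.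
apply: DeriveDef; first by move/derivable_mxP: d => /(_ j 0).
by have := @derive_id _ _ x s; rewrite derive_mx // => /matrixP/(_ j 0); rewrite mxE.
Qed.

Lemma continuous_trmx (p q : nat) : continuous (@trmx R p q).
Proof.
move=> M s /= /(nbhs_ballP M^T) [e /= e0 es].
apply/nbhs_ballP; exists e => //= N [_ MN]; apply: es; split=> // i j.
by rewrite !mxE; exact: MN.
Qed.

Lemma compact_box (lo hi : 'I_n -> R) :
  compact [set x : 'cV[R]_n | forall j, lo j <= x j 0 <= hi j].
Proof.
have -> : [set x : 'cV[R]_n | forall j, lo j <= x j 0 <= hi j] =
    trmx @` [set v : 'rV[R]_n | forall j, `[lo j, hi j]%classic (v 0 j)].
  apply/seteqP; split=> [x xP|_ [v vP <-] j]; last first.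
    by have := vP j; rewrite /= in_itv /= mxE.
  by exists x^T; rewrite ?trmxK // => j; rewrite /= in_itv /= mxE.
apply: continuous_compact; first exact/continuous_subspaceT/continuous_trmx.
apply: (@rV_compact R n (fun j => `[lo j, hi j]%classic)) => j.
exact: segment_compact.
Qed.

Section Codomain.
Variable V : normedModType R.
Implicit Types f g : 'cV[R]_n -> V.

Lemma near_in Omega f g x : open Omega -> (forall y, Omega y -> f y = g y) ->
  Omega x -> \forall y \near x, f y = g y.
Proof. by move=> oO fg Ox; apply: filterS fg _; exact: open_nbhs_nbhs. Qed.

Lemma eq_partial Omega f g j x : open Omega ->
  (forall y, Omega y -> f y = g y) -> Omega x -> partial j f x = partial j g x.
Proof. by move=> oO fg Ox; apply: near_eq_derive; exact: near_in Ox. Qed.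

Lemma near_continuous f g x : (\forall y \near x, f y = g y) ->
  {for x, continuous f} -> {for x, continuous g}.
Proof.
move=> fg; rewrite /prop_for /continuous_at -(nbhs_singleton fg).
move=> cf; apply: (cvg_trans _ cf). exact: (@near_eq_cvg _ _ (nbhs x) _ f g fg).
Qed.

Lemma eq_C1_on Omega f g : open Omega ->
  (forall y, Omega y -> f y = g y) -> C1_on Omega f -> C1_on Omega g.
Proof.
move=> oO fg fC x Ox; have [cf df] := fC x Ox.
have nfg := near_in oO fg Ox.
split=> [|j]; first exact: near_continuous cf.
have [dj cj] := df j; split; first exact: near_eq_derivable dj.
apply: near_continuous cj; apply: (near_in oO _ Ox) => y Oy.
exact: (eq_partial j oO fg Oy).
Qed.

Lemma partialD Omega f g j x : C1_on Omega f -> C1_on Omega g -> Omega x ->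
  partial j (f \+ g) x = partial j f x + partial j g x.
Proof.
move=> fC gC Ox; have [_ /(_ j)[df _]] := fC x Ox; have [_ /(_ j)[dg _]] := gC x Ox.
exact: deriveD.
Qed.

Lemma C1_onD Omega f g : open Omega ->
  C1_on Omega f -> C1_on Omega g -> C1_on Omega (f \+ g).
Proof.
move=> oO fC gC x Ox; have [cf df] := fC x Ox; have [cg dg] := gC x Ox.
split=> [|j]; first exact: continuousD.
split; first by apply: derivableD; [exact: (df j).1|exact: (dg j).1].
apply: (@near_continuous (partial j f \+ partial j g)).
  by apply: (near_in oO _ Ox) => y Oy; rewrite (partialD j fC gC Oy).
exact: continuousD (df j).2 (dg j).2.
Qed.

Lemma C2_onD Omega f g : open Omega ->
  C2_on Omega f -> C2_on Omega g -> C2_on Omega (f \+ g).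
Proof.
move=> oO [fC fC2] [gC gC2]; split=> [|j]; first exact: C1_onD.
apply: (eq_C1_on oO _ (C1_onD oO (fC2 j) (gC2 j))) => y Oy.
by rewrite (partialD j fC gC Oy).
Qed.

Lemma partial2D Omega f g j k x : open Omega ->
  C2_on Omega f -> C2_on Omega g -> Omega x ->
  partial j (partial k (f \+ g)) x = partial j (partial k f) x + partial j (partial k g) x.
Proof.
move=> oO [fC fC2] [gC gC2] Ox; rewrite -(partialD j (fC2 k) (gC2 k) Ox).
by apply: (eq_partial _ oO _ Ox) => y Oy; exact: (partialD k fC gC Oy).
Qed.

Lemma C1_onI Omega f (df : 'I_n -> 'cV[R]_n -> V) : continuous f ->
    (forall j x, is_derive x (delta_mx j 0) f (df j x)) ->
    (forall j, continuous (df j)) ->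
  C1_on Omega f.
Proof.
move=> cf fd cd x _; split=> [|j]; first exact: cf.
have [d _] := fd j x; split=> //.
rewrite (_ : partial j f = df j); first exact: cd.
by apply/funext => y; have [_ <-] := fd j y.
Qed.

End Codomain.

Lemma C1_on_coord m Omega (u : 'cV[R]_n -> 'cV[R]_m) i : open Omega ->
  C1_on Omega u -> C1_on Omega (fun y => u y i 0) /\
  (forall j x, Omega x -> partial j (fun y => u y i 0) x = partial j u x i 0).
Proof.
move=> oO uC.
have pE j x : Omega x -> partial j (fun y => u y i 0) x = partial j u x i 0.
  by move=> Ox; have [_ /(_ j)[d _]] := uC x Ox; rewrite /partial derive_mx // mxE.
have cc (v : 'cV[R]_n -> 'cV[R]_m) x : {for x, continuous v} ->
    {for x, continuous (fun y => v y i 0)}.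
  by move=> cv; apply: (@continuous_comp _ _ _ v (fun M => M i 0)) cv _; exact: coord_continuous.
split=> // x Ox; have [cu du] := uC x Ox; split=> [|j]; first exact: cc.
have [dj cj] := du j; split; first by move/derivable_mxP: dj => /(_ i 0).
apply: near_continuous (cc _ _ cj); apply: (near_in oO _ Ox) => y Oy.
by rewrite pE.
Qed.

Lemma C2_on_coord m Omega (u : 'cV[R]_n -> 'cV[R]_m) i : open Omega ->
  C2_on Omega u -> C2_on Omega (fun y => u y i 0) /\
  (forall j k x, Omega x ->
    partial j (partial k (fun y => u y i 0)) x = partial j (partial k u) x i 0).
Proof.
move=> oO [uC uC2]; have [C1 p1] := C1_on_coord i oO uC.
split=> [|j k x Ox].
  split=> [|j]; first exact: C1.
  have [C1j _] := C1_on_coord i oO (uC2 j).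
  by apply: (eq_C1_on oO _ C1j) => y Oy; rewrite p1.
have [_ <- //] := C1_on_coord i oO (uC2 k).
by apply: (eq_partial _ oO _ Ox) => y Oy; rewrite p1.
Qed.

End Partials.

(** * Closure and boundary of the half-space *)

Section HalfSpace.
Variables (R : realType) (n : nat).
Local Notation half := (@half_space R n).

Lemma open_half_space : open half.
Proof.
apply: (@open_comp _ _ (fun x : 'cV[R]_n.+1 => x ord_max 0) [set t | 0 < t]).
  by move=> x _; exact: coord_continuous.
exact: open_gt.
Qed.

Lemma closure_half_space : closure half = [set x | 0 <= x ord_max 0].
Proof.
apply/seteqP; split=> x; last first.
  move=> /= x0 B /nbhs_ballP[e /= e0 eB]; exists (x + (e / 2) *: delta_mx ord_max 0); split.
    by rewrite /half_space /= !mxE !eqxx mulr1; lra.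
  apply: eB; split=> // i j; rewrite -ball_normE /ball_ /= !mxE opprD addNKr.
  rewrite normrN normrM ger0_norm; last lra.
  have : `|((i == ord_max) && (j == 0))%:R| <= 1 :> R.
    by case: (_ && _); rewrite ?normr1 ?normr0.
  nra.
have cl : closed [set x : 'cV[R]_n.+1 | 0 <= x ord_max 0].
  apply: (@closed_comp _ _ (fun x : 'cV[R]_n.+1 => x ord_max 0) [set t | 0 <= t]).
    by move=> y _; exact: coord_continuous.
  exact: closed_ge.
move=> xc; suff : closure [set x : 'cV[R]_n.+1 | 0 <= x ord_max 0] x.
  by rewrite -(iffLR (closure_id _) cl).
by apply: closureS xc => y /ltW.
Qed.

Lemma frontier_half_space : frontier half = [set x | x ord_max 0 = 0].
Proof.
rewrite /frontier (iffLR (interior_id _) open_half_space) closure_half_space.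
apply/seteqP; split=> x /= => [[x0 /negP]|xn]; last first.
  by rewrite /half_space /= xn lexx ltxx.
by rewrite -leNgt => x1; apply/eqP; rewrite eq_le x0 x1.
Qed.

End HalfSpace.

(** * The maximum principle in the half-space *)

Section Barrier.
Variables (R : realType) (n : nat) (c l : 'I_n -> R).

Definition barrier (x : 'cV[R]_n) : R := \sum_(j < n) (c j * x j 0 ^+ 2 + l j * x j 0).

Let d_barrier k (x : 'cV[R]_n) : R := 2 * c k * x k 0 + l k.

Let is_derive_barrier k x : is_derive x (delta_mx k 0) barrier (d_barrier k x).
Proof.
have -> : barrier = \sum_(j < n) (fun x : 'cV[R]_n => c j * x j 0 ^+ 2 + l j * x j 0).
  by apply/funext => y; rewrite fct_sumE.
have D (j : 'I_n) : is_derive x (delta_mx k 0)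
    (fun x : 'cV[R]_n => c j * x j 0 ^+ 2 + l j * x j 0)
    (d_barrier j x * (j == k)%:R).
  have D1 := is_derive_coord j x (delta_mx k 0).
  have D2 := is_deriveD (is_deriveZ (c j) (is_deriveM D1 D1)) (is_deriveZ (l j) D1).
  apply: is_derive_eq D2 _; rewrite !mxE eqxx andbT /d_barrier.
  by rewrite /GRing.scale /=; ring.
apply: is_derive_eq (is_derive_sum D) _.
rewrite (bigD1 k) //= eqxx mulr1 big1 ?addr0 // => j /negPf ->.
by rewrite mulr0.
Qed.

Let is_derive_d_barrier j k x :
  is_derive x (delta_mx j 0) (d_barrier k) (2 * c k * (k == j)%:R).
Proof.
have D1 := is_derive_coord k x (delta_mx j 0).
apply: is_derive_eq (is_deriveD (is_deriveZ (2 * c k) D1) (is_derive_cst (l k) x _)) _.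
by rewrite !mxE eqxx andbT addr0.
Qed.

Let partial_barrier k : partial k barrier = d_barrier k.
Proof. by apply/funext => x; have [_] := is_derive_barrier k x. Qed.

Lemma continuous_barrier : continuous barrier.
Proof.
apply: continuous_big => [|j _ x].
  exact: (@pseudometric_normed_Zmodule.add_continuous R R^o).
have cj : (fun y : 'cV[R]_n => y j 0) @ x --> x j 0 by exact: coord_continuous.
have cj2 : (fun y : 'cV[R]_n => y j 0 ^+ 2) @ x --> x j 0 ^+ 2 by exact: (cvgM cj cj).
exact: (cvgD (cvgMl_tmp cj2) (cvgMl_tmp cj)).
Qed.

Lemma C2_barrier Omega : C2_on Omega barrier.
Proof.
have cd k : continuous (d_barrier k).
  move=> x; have ck : (fun y : 'cV[R]_n => y k 0) @ x --> x k 0 by exact: coord_continuous.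
  exact: (cvgD (cvgMl_tmp ck) (cvg_cst (l k))).
split=> [|k]; first exact: (C1_onI continuous_barrier is_derive_barrier cd).
rewrite partial_barrier; apply: (C1_onI (cd k) (fun j x => is_derive_d_barrier j k x)).
by move=> j; exact: cst_continuous.
Qed.

Lemma partial2_barrier j k x : partial j (partial k barrier) x = 2 * c k * (k == j)%:R.
Proof. by rewrite partial_barrier; have [_] := is_derive_d_barrier j k x. Qed.

End Barrier.

Section MaximumPrinciple.
Variables (R : realType) (n : nat) (b : 'I_n.+1 -> 'I_n.+1 -> R).
Hypothesis b_sym : forall j k, b j k = b k j.
Hypothesis b_pos : forall x, (exists i, x i != 0) -> 0 < quad b x.

Let quad_b_ge0 x : 0 <= quad b x.
Proof.
have [x0|/forallNP no] := pselect (exists i, x i != 0); first exact/ltW/b_pos.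
rewrite /quad big1 // => j _; rewrite big1 // => k _.
by have /negP/negPn/eqP -> := no j; rewrite mulr0 mul0r.
Qed.

Let b_diag i : 0 < b i i.
Proof.
have := b_pos (x := fun k => 0 - (-1) * (k == i)%:R).
rewrite quad_sub // [quad b _]big1 => [|j _]; last by rewrite big1 // => k _; rewrite mulr0.
rewrite big1 => [|k _]; last by rewrite mul0r.
rewrite mulr0 subrr add0r sqrrN expr1n mul1r; apply.
by exists i; rewrite eqxx mulr1 opprK add0r oner_neq0.
Qed.

(** The Hessian at a local minimum and the coefficient matrix are both semidefinite, so their
    contraction is nonnegative. *)
Lemma local_min_operator Omega (f : 'cV[R]_n.+1 -> R) x : open Omega -> C2_on Omega f -> Omega x ->
  (\forall y \near x, f x <= f y) -> 0 <= scalar_op b f x.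
Proof.
move=> oO f2 Ox fmin; apply: psd_contraction_ge0 => // s.
have := local_min_hessian (\col_j s j) oO f2 Ox fmin.
congr (_ <= _); apply: eq_bigr => j _; apply: eq_bigr => k _.
by rewrite !mxE mulrC mulrA.
Qed.

(** Were [f x0 < alpha], minimize [f + w] over a large box containing [x0]. On the faces [f + w] is
    at least [alpha]; an interior minimum contradicts the strict sign of the operator on [w]. Yet
    [w x0] is smaller than [alpha - f x0]. *)
Lemma half_space_min (f : 'cV[R]_n.+1 -> R) (alpha : R) :
    C2_on half_space f -> Cb_closure half_space f ->
    (forall x, half_space x -> scalar_op b f x = 0) ->
    (forall x, frontier half_space x -> alpha <= f x) ->
  forall x, half_space x -> alpha <= f x.
Proof.
move=> f2 [cf bf] fL fb x0 hx0.
have [M0 M0gt0 M0P] := ex_strict_bound_gt0 bf.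
have {}bf (x : 'cV[R]_n.+1) : 0 <= x ord_max 0 -> `|f x| <= M0.
  by move=> xn; apply/ltW/M0P; rewrite closure_half_space.
rewrite frontier_half_space in fb.
set e := (ord_max : 'I_n.+1).
rewrite leNgt; apply/negP => fx0.
pose S := \sum_(j < n.+1 | j != e) b j j.
have S0 : 0 <= S by apply: sumr_ge0 => j _; exact: ltW.
(* The quotient makes [S - K b e e = - b e e], the source of strictness; the [+ 1] also gives
   [K >= 1], used on the top face. *)
pose K := S / b e e + 1.
have K1 : 1 <= K by rewrite lerDr divr_ge0 // ltW.
have K0 : 0 <= K by exact: le_trans K1.
(* As [f >= - M0], adding [M] lifts [f] above [alpha]. *)
pose M := M0 + `|alpha|.
have Mgt0 : 0 < M by rewrite ltr_wpDr.
pose T := \sum_(j < n.+1 | j != e) x0 j 0 ^+ 2.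
have T0 : 0 <= T by apply: sumr_ge0 => j _; exact: sqr_ge0.
have xe0 : 0 < x0 e 0 by [].
pose d := alpha - f x0; have d0 : 0 < d by rewrite subr_gt0.
(* The sum puts [x0] in the box, the last term makes [w x0] smaller than [d], and the [1] gives
   [r >= 1]. *)
pose r := 1 + \sum_j `|x0 j 0| + M * (T + 2 * K * x0 e 0) / d.
have TK0 : 0 <= M * (T + 2 * K * x0 e 0) / d.
  apply: (divr_ge0 _ (ltW d0)); apply: (mulr_ge0 (ltW Mgt0)).
  by apply: (addr_ge0 T0); apply: (mulr_ge0 _ (ltW xe0)); exact: mulr_ge0.
have sum0 : 0 <= \sum_j `|x0 j 0| by exact: sumr_ge0.
have r1 : 1 <= r by rewrite /r -addrA lerDl addr_ge0.
have r0 : 0 < r by exact: lt_le_trans r1.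
have xr j : `|x0 j 0| <= r.
  rewrite /r (bigD1 j) //=; have : 0 <= \sum_(i < n.+1 | i != j) `|x0 i 0| by exact: sumr_ge0.
  lra.
(* [w] is [M] times [|x'|^2/r^2 + K (2 x_n/r - x_n^2/r^2)]: it is at least [M] on
   the lateral and top faces of the box, is a strict supersolution because [K]
   is large, and tends to [0] at [x0] as [r] grows. *)
pose c j := if j == e then - (M * K / r ^+ 2) else M / r ^+ 2.
pose l j := if j == e then 2 * M * K / r else 0.
pose w := barrier c l.
have wE (x : 'cV[R]_n.+1) : w x = M / r ^+ 2 * (\sum_(j < n.+1 | j != e) x j 0 ^+ 2 +
                                K * (x e 0 * (2 * r - x e 0))).
  rewrite /w /barrier (bigD1 e) //= /c /l eqxx [RHS]mulrDr [LHS]addrC; congr (_ + _).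
    rewrite mulr_sumr; apply: eq_bigr => j /negPf ->; by rewrite mul0r addr0.
  by field; rewrite gt_eqF.
pose box := [set x : 'cV[R]_n.+1 | forall j, (if j == e then 0 else - r) <= x j 0 <= r].
have box_half (x : 'cV[R]_n.+1) : box x -> 0 <= x e 0 by move=> /(_ e); rewrite eqxx => /andP[].
have x0box : box x0.
  move=> j; have := xr j; rewrite ler_norml => /andP[xj ->]; rewrite andbT.
  by case: eqP => // ->; exact: ltW.
have [|p pbox pmin] := @compact_EVT_min _ R (f \+ w) box (ex_intro _ x0 x0box)
    (@compact_box R n.+1 _ _).
  move=> x; apply: continuousD.
    apply: continuous_subspaceW cf x => y yb.
    by rewrite closure_half_space; exact: box_half.
  by apply: continuous_subspaceT x; exact: continuous_barrier.
rewrite inE in pbox.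
have {}pmin y : box y -> f p + w p <= f y + w y by move=> yb; apply: pmin; rewrite inE.
have pe0 := box_half _ pbox.
have per : p e 0 <= r by have /andP[] := pbox e.
have Mr0 : 0 < M / r ^+ 2 by rewrite divr_gt0 // exprn_gt0.
have Ksum : 0 <= K * (p e 0 * (2 * r - p e 0)).
  by rewrite mulr_ge0 // ?mulr_ge0 //; lra.
have sq0 (x : 'cV[R]_n.+1) : 0 <= \sum_(j < n.+1 | j != e) x j 0 ^+ 2.
  by apply: sumr_ge0 => j _; exact: sqr_ge0.
have w_big : r ^+ 2 <= \sum_(j < n.+1 | j != e) p j 0 ^+ 2 + K * (p e 0 * (2 * r - p e 0)) ->
    alpha <= f p + w p.
  move=> big.
  have wM : M <= w p.
    rewrite wE -[leLHS](divfK (lt0r_neq0 (exprn_gt0 2 r0))).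
    by rewrite ler_wpM2l // ltW.
  have := bf p pe0; rewrite ler_norml => /andP[fp _].
  have := ler_norm alpha; rewrite /M in wM; lra.
suff ap : alpha <= f p + w p.
  have := le_trans ap (pmin x0 x0box); apply/negP; rewrite -ltNge.
  suff : w x0 < d by rewrite /d; lra.
  have : w x0 <= M * (T + 2 * K * x0 e 0) / r.
    rewrite wE -/T -[leRHS]mulrA.
    have -> : M / r ^+ 2 * (T + K * (x0 e 0 * (2 * r - x0 e 0))) =
        M * ((T / r + K * x0 e 0 * (2 - x0 e 0 / r)) / r) by field; rewrite gt_eqF.
    rewrite ler_pM2l // ler_pM2r ?invr_gt0 //.
    have : T / r <= T by rewrite ler_pdivrMr // ler_peMr.
    have q0 : 0 <= x0 e 0 / r by rewrite divr_ge0 // ltW.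
    have Kx0 : 0 <= K * x0 e 0 by rewrite mulr_ge0 // ltW.
    have := mulr_ge0 Kx0 q0; rewrite mulrBr; lra.
  move=> /le_lt_trans; apply; rewrite ltr_pdivrMr // [d * r]mulrC -ltr_pdivrMr //.
  by rewrite /r; lra.
(* The minimum point is located in turn on the bottom face, the top face, a lateral face, and in the
   interior. *)
have [pe|pe] := eqVneq (p e 0) 0.
  have := fb p pe; rewrite wE.
  have : 0 <= M / r ^+ 2 * (\sum_(j < n.+1 | j != e) p j 0 ^+ 2 + K * (p e 0 * (2 * r - p e 0))).
    by rewrite mulr_ge0 ?addr_ge0 // ltW.
  lra.
have {}pe0 : 0 < p e 0 by rewrite lt_neqAle eq_sym pe.
have [per'|per'] := eqVneq (p e 0) r.
  apply: w_big; rewrite per'; apply: le_trans (_ : K * (r * (2 * r - r)) <= _).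
    have : 0 <= r ^+ 2 by exact: sqr_ge0.
    nra.
  by rewrite lerDr.
have {}per : p e 0 < r by rewrite lt_neqAle per'.
have [[j [je pj]]|/forallNP inside] := pselect (exists j, j != e /\ `|p j 0| = r).
  have rE : r ^+ 2 = p j 0 ^+ 2 by rewrite -pj real_normK ?num_real.
  apply: w_big; rewrite (bigD1 j) //= rE -addrA lerDl; apply: (addr_ge0 _ Ksum).
  by apply: sumr_ge0 => k _; exact: sqr_ge0.
have ins j : j != e -> `|p j 0| < r.
  move=> je; rewrite lt_neqAle; apply/andP; split.
    by apply/negP => /eqP pj; apply: (inside j).
  by have := pbox j; rewrite (negPf je) ler_norml.
have fw2 : C2_on half_space (f \+ w).
  exact: (C2_onD (@open_half_space R n) f2 (@C2_barrier _ _ c l _)).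
have near_box j : \forall y \near p, (if j == e then 0 else - r) <= (y : 'cV[R]_n.+1) j 0 <= r.
  have cj : (fun y : 'cV[R]_n.+1 => y j 0) @ p --> p j 0 by exact: coord_continuous.
  near=> y; apply/andP; split; last first.
    apply/ltW; near: y; apply: (cvgr_lt _ cj).
    by have [->|/ins] := eqVneq j e; rewrite // ltr_norml => /andP[].
  apply/ltW; near: y; apply: (cvgr_gt _ cj).
  by case: eqP => [->|/eqP/ins]; rewrite // ltr_norml => /andP[].
have := @local_min_operator half_space (f \+ w) p (@open_half_space _ _) fw2 pe0.
have -> : scalar_op b (f \+ w) p = - (2 * M * b e e / r ^+ 2).
  have -> : scalar_op b (f \+ w) p = scalar_op b f p + scalar_op b w p.
    rewrite /scalar_op -big_split; apply: eq_bigr => j _ /=.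
    rewrite -big_split; apply: eq_bigr => k _ /=; rewrite -mulrDr; congr (_ * _).
    exact: (partial2D _ _ (@open_half_space R n) f2 (@C2_barrier _ _ c l _) pe0).
  rewrite fL // add0r /scalar_op.
  transitivity (\sum_j 2 * (c j * b j j)).
    apply: eq_bigr => j _; rewrite (bigD1 j) //= partial2_barrier eqxx mulr1.
    rewrite big1 => [|k /negPf kj]; first by rewrite addr0 mulrC mulrA.
    by rewrite partial2_barrier kj !mulr0.
  rewrite (bigD1 e) //= {1}/c eqxx.
  have -> : \sum_(i < n.+1 | i != e) 2 * (c i * b i i) = 2 * (M / r ^+ 2 * S).
    by rewrite !mulr_sumr; apply: eq_bigr => j /negPf je; rewrite /c je.
  rewrite /K; field; by rewrite !gt_eqF.
move=> /(_ (filterS pmin (filter_forall _ near_box))); rewrite oppr_ge0 leNgt => /negP[].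
by apply: divr_gt0; [rewrite !mulr_gt0|exact: exprn_gt0].
Unshelve. all: by end_near. Qed.

End MaximumPrinciple.

(** * Vector functions given by their components *)

Section Components.
Variables (R : realType) (n : nat).
Implicit Types (Omega : set 'cV[R]_n) (x : 'cV[R]_n).

Lemma ler_coord_norm (m : nat) (v : 'cV[R]_m) i : `|v i 0| <= `|v|.
Proof.
by rewrite [leRHS]/Num.Def.normr /= mx_normrE (le_bigmax _ _ (i, 0)).
Qed.

Lemma ler_norm_coord (m : nat) (v : 'cV[R]_m) (M : R) :
  0 <= M -> (forall i, `|v i 0| <= M) -> `|v| <= M.
Proof.
move=> M0 vM; rewrite /Num.Def.normr /= mx_normrE bigmax_le // => -[i j] _ /=.
by rewrite (ord1 j).
Qed.

Lemma continuous_col (T : topologicalType) m (u : T -> 'cV[R]_m) (x : T) :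
  (forall i, {for x, continuous (fun y => u y i 0)}) -> {for x, continuous u}.
Proof.
move=> cu; apply/cvgrPdist_le => eps eps0.
have nc i : \forall y \near x, `|u x i 0 - u y i 0| <= eps.
  by move/cvgrPdist_le: (cu i); apply.
apply: filterS (filter_forall _ nc) => y uxy; apply: ler_norm_coord; first exact: ltW.
by move=> i; rewrite !mxE.
Qed.

Lemma C1_on_col m Omega (u : 'cV[R]_n -> 'cV[R]_m) : open Omega ->
  (forall i, C1_on Omega (fun y => u y i 0)) ->
  C1_on Omega u.
Proof.
move=> oO uC.
have du x j : Omega x -> derivable u x (delta_mx j 0).
  move=> Ox; apply/derivable_mxP => i k; rewrite (ord1 k).
  by have [_ /(_ j)[]] := uC i x Ox.
have pE x j i : Omega x -> partial j (fun y => u y i 0) x = partial j u x i 0.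
  by move=> Ox; rewrite /partial derive_mx ?mxE //; exact: du.
move=> x Ox; split=> [|j].
  by apply: continuous_col => i; have [] := uC i x Ox.
split; first exact: du.
apply: continuous_col => i; have [_ /(_ j)[_ ci]] := uC i x Ox.
by apply: near_continuous ci; apply: (near_in oO _ Ox) => y Oy; exact: pE.
Qed.

Lemma C2_on_col m Omega (u : 'cV[R]_n -> 'cV[R]_m) : open Omega ->
  (forall i, C2_on Omega (fun y => u y i 0)) ->
  C2_on Omega u.
Proof.
move=> oO uC; have C1 : C1_on Omega u by apply: (C1_on_col oO) => i; exact: (uC i).1.
split=> [|j]; first exact: C1.
apply: (C1_on_col oO) => i; apply: (eq_C1_on oO _ ((uC i).2 j)) => y Oy.
by have [_ ->] := C1_on_coord i oO C1.
Qed.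

End Components.

(** * Quadratic monomials as test functions *)

Section Products.
Variables (R : realType) (n : nat) (j k : 'I_n) (c : R).

Let prod (y : 'cV[R]_n) : R := c * (y j 0 * y k 0).
Let dprod p (y : 'cV[R]_n) : R := c * ((k == p)%:R * y j 0 + (j == p)%:R * y k 0).

Let is_derive_prod p x : is_derive x (delta_mx p 0) prod (dprod p x).
Proof.
have Dj := is_derive_coord j x (delta_mx p 0).
have Dk := is_derive_coord k x (delta_mx p 0).
apply: is_derive_eq (is_deriveZ c (is_deriveM Dj Dk)) _.
by rewrite !mxE !eqxx !andbT /GRing.scale /= /dprod; ring.
Qed.

Let is_derive_dprod p q x : is_derive x (delta_mx q 0) (dprod p)
  (c * ((j == q)%:R * (k == p)%:R + (k == q)%:R * (j == p)%:R)).
Proof.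
have Dj := is_derive_coord j x (delta_mx q 0).
have Dk := is_derive_coord k x (delta_mx q 0).
apply: is_derive_eq (is_deriveZ c
  (is_deriveD (is_deriveZ (k == p)%:R Dj) (is_deriveZ (j == p)%:R Dk))) _.
by rewrite !mxE !eqxx !andbT /GRing.scale /=; ring.
Qed.

Let partial_prod p : partial p prod = dprod p.
Proof. by apply/funext => x; have [_] := is_derive_prod p x. Qed.

Lemma partial2_prod q p x : partial q (partial p prod) x =
  c * ((j == q)%:R * (k == p)%:R + (k == q)%:R * (j == p)%:R).
Proof. by rewrite partial_prod; have [_] := is_derive_dprod p q x. Qed.

Lemma C2_prod Omega : C2_on Omega prod.
Proof.
have ci i (x : 'cV[R]_n) : (fun y : 'cV[R]_n => y i 0) @ x --> x i 0 by exact: coord_continuous.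
have cd p : continuous (dprod p).
  by move=> x; exact: (cvgMl_tmp (cvgD (cvgMl_tmp (ci j x)) (cvgMl_tmp (ci k x)))).
split=> [|p].
  apply: (C1_onI _ is_derive_prod cd) => x.
  exact: (cvgMl_tmp (cvgM (ci j x) (ci k x))).
rewrite partial_prod; apply: (C1_onI (cd p) (is_derive_dprod p)) => q.
exact: cst_continuous.
Qed.

End Products.

Lemma sum_delta2 (R : comRingType) (n : nat) (j k : 'I_n) (F : 'I_n -> 'I_n -> R) :
  \sum_(q < n) \sum_(p < n)
    F q p * ((j == q)%:R * (k == p)%:R + (k == q)%:R * (j == p)%:R) = F j k + F k j.
Proof.
have D (r s : 'I_n) : \sum_(q < n) \sum_(p < n) F q p * ((r == q)%:R * (s == p)%:R) = F r s.
  rewrite (bigD1 r) //= (bigD1 s) //= !eqxx !mulr1 big1 => [|p ps]; last first.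
    by rewrite [s == p]eq_sym (negPf ps) !mulr0.
  rewrite addr0 big1 ?addr0 // => q qr; rewrite big1 // => p _.
  by rewrite [r == q]eq_sym (negPf qr) mul0r mulr0.
rewrite -[F j k]D -[F k j]D -big_split; apply: eq_bigr => q _ /=.
by rewrite -big_split; apply: eq_bigr => p _ /=; rewrite mulrDr.
Qed.

(** * Sufficiency: systems of the form A diag(L_1, ..., L_m) *)

Section DiagonalOperator.
Variables (R : realType) (n m : nat) (Ac : 'I_n.+1 -> 'I_n.+1 -> 'M[R]_m.+1).
Variables (A : 'M[R]_m.+1) (b : 'I_m.+1 -> 'I_n.+1 -> 'I_n.+1 -> R).
Hypothesis AcE : forall j k, Ac j k = A *m diag_mx (\row_i b i j k).

Lemma system_op_diag (u : 'cV[R]_n.+1 -> 'cV[R]_m.+1) Omega x : open Omega ->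
    C2_on Omega u -> Omega x ->
  system_op Ac u x = A *m \col_i scalar_op (b i) (fun y => u y i 0) x.
Proof.
move=> oO u2 Ox.
have -> : \col_i scalar_op (b i) (fun y => u y i 0) x =
    \sum_(j < n.+1) \sum_(k < n.+1)
      diag_mx (\row_i b i j k) *m partial j (partial k u) x.
  apply/colP => i; rewrite mxE summxE; apply: eq_bigr => j _.
  rewrite summxE; apply: eq_bigr => k _.
  by have [_ ->] := C2_on_coord i oO u2; rewrite // mul_diag_mx !mxE.
rewrite mulmx_sumr; apply: eq_bigr => j _; rewrite mulmx_sumr; apply: eq_bigr => k _.
by rewrite AcE mulmxA.
Qed.

End DiagonalOperator.

Section Sufficiency.
Variables (R : realType) (n m : nat) (Ac : 'I_n.+1 -> 'I_n.+1 -> 'M[R]_m.+1).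
Variables (A : 'M[R]_m.+1) (a : 'I_m.+1 -> 'I_n.+1 -> 'I_n.+1 -> R).
Hypothesis Ac_sym : forall j k, Ac j k = Ac k j.
Hypothesis AcE : eq_op_C2 (system_op Ac) (fun u x => A *m diag_op a u x).

(** The action on C^2 functions sees only the symmetric part of [a i]. *)
Let b i j k := (a i j k + a i k j) / 2.

Let open_setT : open [set: 'cV[R]_n.+1]. Proof. exact: openT. Qed.

(** Testing the operators on the monomial [y_j y_k] placed in component [q] isolates column [q].
    Both orders of differentiation contribute, and [Ac_sym] merges the two terms on the left. *)
Lemma eq_op_coef j k : Ac j k = A *m diag_mx (\row_i b i j k).
Proof.
apply/matrixP => p q.
pose u (y : 'cV[R]_n.+1) : 'cV[R]_m.+1 := \col_i ((i == q)%:R * (y j 0 * y k 0)).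
have ui i : (fun y => u y i 0) = (fun y => (i == q)%:R * (y j 0 * y k 0)).
  by apply/funext => y; rewrite mxE.
have u2 : C2_on setT u.
  by apply: (C2_on_col open_setT) => i; rewrite ui; exact: C2_prod.
have /matrixP/(_ p 0) := AcE u2 0.
pose d (r s : 'I_n.+1) : R := (j == r)%:R * (k == s)%:R + (k == r)%:R * (j == s)%:R.
have -> : system_op Ac u 0 p 0 = 2 * Ac j k p q.
  transitivity (\sum_(r < n.+1) \sum_(s < n.+1) Ac r s p q * d r s).
    rewrite /system_op summxE; apply: eq_bigr => r _.
    rewrite summxE; apply: eq_bigr => s _.
    rewrite mxE (bigD1 q) //= big1 ?addr0 => [|i iq].
      by have [_ <- //] := C2_on_coord q open_setT u2; rewrite ui partial2_prod eqxx mul1r.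
    have [_ <- //] := C2_on_coord i open_setT u2.
    by rewrite ui partial2_prod (negPf iq) mul0r mulr0.
  by rewrite (sum_delta2 j k (fun r s => Ac r s p q)) (Ac_sym k j) mulr_natl mulr2n.
have -> : (A *m diag_op a u 0) p 0 = A p q * (a q j k + a q k j).
  rewrite mxE (bigD1 q) //= big1 ?addr0 => [|i iq]; rewrite mxE /scalar_op ui.
    congr (_ * _); rewrite -sum_delta2; apply: eq_bigr => r _; apply: eq_bigr => s _.
    by rewrite partial2_prod eqxx mul1r.
  rewrite big1 ?mulr0 // => r _; rewrite big1 // => s _.
  by rewrite partial2_prod (negPf iq) mul0r mulr0.
by move=> E; rewrite mul_mx_diag !mxE /b mulrA -E; field.
Qed.

(** Inverting [A] decouples the system into scalar equations, to each of which the maximum principle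
    applies because an elliptic form is definite. *)
Lemma orthant_invariant (alpha : 'I_m.+1 -> R) :
    A \in unitmx -> (forall i, elliptic (a i)) ->
  invariant_for (orthant alpha) (system_op Ac) half_space.
Proof.
move=> Au ell u u2 [cu bu] uL ub x hx i.
have oH := @open_half_space R n.
have [ui2 _] := C2_on_coord i oH u2.
have uiL y : half_space y -> scalar_op (b i) (fun y => u y i 0) y = 0.
  move=> hy; have := uL y hy; rewrite (system_op_diag eq_op_coef oH u2 hy) => E.
  have /colP/(_ i) : \col_i scalar_op (b i) (fun y => u y i 0) y = 0.
    by rewrite -[LHS](mulKmx Au) E mulmx0.
  by rewrite !mxE.
have uiC : Cb_closure half_space (fun y => u y i 0).
  split.
    move=> y; have ci := @coord_continuous R m.+1 1 i 0 (u y).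
    exact: (cvg_comp _ _ (cu y) ci).
  move: bu; rewrite /bounded_near; apply: filterS => M uM y hy.
  exact: le_trans (ler_coord_norm _ _) (uM y hy).
have uib y : frontier half_space y -> alpha i <= u y i 0 by move=> /ub.
have b_sym j k : b i j k = b i k j by rewrite /b addrC.
have quad_ab s : quad (b i) s = quad (a i) s.
  have sw : \sum_(j < n.+1) \sum_(k < n.+1) a i k j * s j * s k = quad (a i) s.
    rewrite exchange_big; apply: eq_bigr => j _; apply: eq_bigr => k _; ring.
  have -> : quad (a i) s = (quad (a i) s + quad (a i) s) / 2 by field.
  rewrite -{2}sw -big_split mulr_suml; apply: eq_bigr => j _ /=.
  by rewrite -big_split mulr_suml; apply: eq_bigr => k _ /=; rewrite /b; field.
have nz (s : 'I_n.+1 -> R) : (exists j, s j != 0) -> quad (b i) s != 0.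
  move=> [j sj]; rewrite quad_ab.
  have := ell i (\col_j s j); rewrite /quad.
  under eq_bigr do under eq_bigr do rewrite !mxE.
  by apply; apply: contra_neq sj => /colP/(_ j); rewrite !mxE.
have [pos|neg] := quad_definite nz.
  exact: (half_space_min b_sym pos ui2 uiC uiL uib hx).
(* For a negative definite form, the sign of the operator is changed; its solutions stay the
   same. *)
have oppE s : quad (fun j k => - b i j k) s = - quad (b i) s.
  rewrite /quad -sumrN; apply: eq_bigr => j _; rewrite -sumrN; apply: eq_bigr => k _.
  by rewrite !mulNr.
apply: (@half_space_min _ _ (fun j k => - b i j k) _ _ _ _ ui2 uiC _ uib _ hx).
- by move=> j k; rewrite b_sym.
- by move=> s /neg; rewrite oppE oppr_gt0.
- move=> y /uiL E; rewrite /scalar_op; apply/eqP; rewrite -oppr_eq0 -[X in _ == X]E.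
  apply/eqP; rewrite -sumrN; apply: eq_bigr => j _; rewrite -sumrN; apply: eq_bigr => k _.
  by rewrite mulNr opprK.
Qed.

End Sufficiency.

(** * Oscillating solutions and necessity *)

Section Chain.
Variables (R : realType) (n : nat).
Implicit Types (x v : 'cV[R]_n).

Lemma is_derive_along (f : 'cV[R]_n -> R) x v (d : R) :
  is_derive (0 : R) 1 (fun t : R => f (t *: v + x)) d -> is_derive x v f d.
Proof.
have E : (fun h : R => h^-1 *: (((fun t : R => f (t *: v + x)) \o shift 0) (h *: 1)
            - f (0 *: v + x))) =
    (fun h : R => h^-1 *: ((f \o shift x) (h *: v) - f x)).
  by apply/funext => h /=; rewrite [h *: 1]mulr1 addr0 scale0r add0r.
by case; rewrite /derivable /derive /= E => dh dE; apply: DeriveDef.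
Qed.

Lemma is_derive1_comp (h g : R -> R) (t dg dh : R) :
  is_derive t 1 g dg -> is_derive (g t) 1 h dh ->
  is_derive t 1 (fun r => h (g r)) (dh * dg).
Proof.
move=> [Dg gE] [Dh hE]; apply: DeriveDef.
  by apply/derivable1_diffP/differentiable_comp; exact/derivable1_diffP.
by rewrite -derive1E (derive1_comp Dg Dh) !derive1E gE hE.
Qed.

Lemma is_derive_comp (h : R -> R) (g : 'cV[R]_n -> R) x v (dg dh : R) :
    is_derive x v g dg -> is_derive (g x) 1 h dh ->
  is_derive x v (fun y => h (g y)) (dh * dg).
Proof.
move=> [Dg gE] Dh; apply: is_derive_along.
have Dl : is_derive (0 : R) 1 (fun t : R => g (t *: v + x)) dg.
  by have := @is_derive_line R n g x v 0; rewrite scale0r add0r gE; apply.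
have {}Dh : is_derive ((fun t : R => g (t *: v + x)) 0) 1 h dh.
  by rewrite scale0r add0r.
exact: is_derive1_comp Dl Dh.
Qed.

Definition lin (s : 'I_n -> R) x : R := \sum_(j < n) s j * x j 0.

Lemma is_derive_lin s x (k : 'I_n) : is_derive x (delta_mx k 0) (lin s) (s k).
Proof.
have -> : lin s = \sum_(j < n) (fun y : 'cV[R]_n => s j * y j 0).
  by apply/funext => y; rewrite fct_sumE.
have D j := is_deriveZ (s j) (is_derive_coord j x (delta_mx k 0)).
apply: is_derive_eq (is_derive_sum D) _.
rewrite (bigD1 k) //= big1 ?addr0 => [|j jk]; rewrite !mxE.
  by rewrite !eqxx [LHS]mulr1.
by rewrite (negPf jk) scaler0.
Qed.

Lemma continuous_lin s : continuous (lin s).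
Proof.
apply: continuous_big => [|j _ x].
  exact: (@pseudometric_normed_Zmodule.add_continuous R R^o).
have cj : (fun y : 'cV[R]_n => y j 0) @ x --> x j 0 by exact: coord_continuous.
exact: (cvgMl_tmp cj).
Qed.

End Chain.

(** * Complex exponentials with a linear factor *)

Section Wave.
Variables (R : realType) (n : nat) (k : 'I_n -> R[i]) (e : 'I_n).
Local Notation C := R[i].
Implicit Types (x : 'cV[R]_n) (a b : C).
Local Notation Re := (@complex.Re R).
Local Notation Im := (@complex.Im R).

(* The real part of [exp (i k.x) (a + i x_e b)]. *)
Definition wave a b x : R :=
  expR (lin (fun j => - Im (k j)) x) *
    (cos (lin (fun j => Re (k j)) x) * (Re a - x e 0 * Im b) -
     sin (lin (fun j => Re (k j)) x) * (Im a + x e 0 * Re b)).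

Lemma waveD a b a' b' x : wave a b x + wave a' b' x = wave (a + a') (b + b') x.
Proof. by rewrite /wave !raddfD /=; case: a b a' b' => [? ?] [? ?] [? ?] [? ?] /=; ring. Qed.

Lemma waveZ (c : R) a b x : c * wave a b x = wave (c%:C%C * a) (c%:C%C * b) x.
Proof. by rewrite /wave; case: a b => [? ?] [? ?] /=; ring. Qed.

Lemma wave0 x : wave 0 0 x = 0.
Proof. by rewrite /wave /=; ring. Qed.

Lemma wave_sum (I : Type) (r : seq I) (a b : I -> C) x :
  \sum_(i <- r) wave (a i) (b i) x = wave (\sum_(i <- r) a i) (\sum_(i <- r) b i) x.
Proof.
elim: r => [|i r IH]; first by rewrite !big_nil wave0.
by rewrite !big_cons IH waveD.
Qed.

(** Differentiation in [x_j] acts on the amplitude: [a + i x_e b] becomes [i k_j (a + i x_e b)],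
    plus [i b] when [j = e]. *)
Definition dwave_a (j : 'I_n) a b : C := 'i%C * (k j * a + (j == e)%:R * b).
Definition dwave_b (j : 'I_n) b : C := 'i%C * (k j * b).

Lemma is_derive_wave a b j x :
  is_derive x (delta_mx j 0) (wave a b) (wave (dwave_a j a b) (dwave_b j b) x).
Proof.
have De := is_derive_comp (is_derive_lin (fun j => - Im (k j)) x j) (is_derive_expR _).
have Dc := is_derive_comp (is_derive_lin (fun j => Re (k j)) x j) (is_derive_cos _).
have Ds := is_derive_comp (is_derive_lin (fun j => Re (k j)) x j) (is_derive_sin _).
have Dx := is_derive_coord e x (delta_mx j 0).
have DA := is_deriveB (is_derive_cst (Re a) x (delta_mx j 0)) (is_deriveZ (Im b) Dx).
have DB := is_deriveD (is_derive_cst (Im a) x (delta_mx j 0)) (is_deriveZ (Re b) Dx).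
have D := is_deriveM De (is_deriveB (is_deriveM Dc DA) (is_deriveM Ds DB)).
have E : wave a b = (fun y => expR (lin (fun j => - Im (k j)) y)) \*
    ((fun y => cos (lin (fun j => Re (k j)) y)) \* (cst (Re a) \- (fun y => Im b *: y e 0)) \-
     (fun y => sin (lin (fun j => Re (k j)) y)) \* (cst (Im a) \+ (fun y => Re b *: y e 0))).
  by apply/funext => y; rewrite /wave /= /GRing.scale /=; ring.
rewrite E; apply: is_derive_eq D _.
clear.
have key (d E0 C0 S0 y kr ki ar ai br bi : R) :
  E0 * (C0 * (0 - bi * d) + (ar - bi * y) * (- S0 * kr) -
        (S0 * (0 + br * d) + (ai + br * y) * (C0 * kr))) +
    (C0 * (ar - bi * y) - S0 * (ai + br * y)) * (E0 * - ki) =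
  E0 * (C0 * (0 * (kr * ar - ki * ai + (d * br - 0 * bi)) -
              1 * (kr * ai + ki * ar + (d * bi + 0 * br)) -
              y * (0 * (kr * bi + ki * br) + 1 * (kr * br - ki * bi))) -
        S0 * (0 * (kr * ai + ki * ar + (d * bi + 0 * br)) +
              1 * (kr * ar - ki * ai + (d * br - 0 * bi)) +
              y * (0 * (kr * br - ki * bi) - 1 * (kr * bi + ki * br)))) by ring.
rewrite !mxE eqxx andbT eq_sym /wave /dwave_a /dwave_b.
rewrite /GRing.scale /= !fctE /GRing.scale /=.
move: (expR _) (cos _) (sin _) => E0 C0 S0.
case: (k j) a b => [kr ki] [ar ai] [br bi].
by case: (j == e) => /=; [exact: (key 1)|exact: (key 0)].
Qed.

Lemma continuous_wave a b : continuous (wave a b).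
Proof.
move=> x.
have cx : (fun y : 'cV[R]_n => y e 0) @ x --> x e 0 by exact: coord_continuous.
have ce : (fun y => expR (lin (fun j => - Im (k j)) y)) @ x --> expR (lin (fun j => - Im (k j)) x).
  exact: (cvg_comp _ _ (@continuous_lin _ _ _ x) (@continuous_expR R _)).
have cc : (fun y => cos (lin (fun j => Re (k j)) y)) @ x --> cos (lin (fun j => Re (k j)) x).
  exact: (cvg_comp _ _ (@continuous_lin _ _ _ x) (@continuous_cos R _)).
have cs : (fun y => sin (lin (fun j => Re (k j)) y)) @ x --> sin (lin (fun j => Re (k j)) x).
  exact: (cvg_comp _ _ (@continuous_lin _ _ _ x) (@continuous_sin R _)).
exact: (cvgM ce (cvgB (cvgM cc (cvgB (cvg_cst (Re a)) (cvgMr_tmp cx)))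
                      (cvgM cs (cvgD (cvg_cst (Im a)) (cvgMr_tmp cx))))).
Qed.

Lemma partial_wave a b j : partial j (wave a b) = wave (dwave_a j a b) (dwave_b j b).
Proof. by apply/funext => x; have [_] := is_derive_wave a b j x. Qed.

Lemma C1_wave a b Omega : C1_on Omega (wave a b).
Proof.
have cd j : continuous (wave (dwave_a j a b) (dwave_b j b)) by exact: continuous_wave.
exact: (C1_onI (@continuous_wave a b) (fun j x => is_derive_wave a b j x) cd).
Qed.

Lemma C2_wave a b Omega : C2_on Omega (wave a b).
Proof.
by split=> [|j]; [exact: C1_wave|rewrite partial_wave; exact: C1_wave].
Qed.

(** The decay absorbs the linear factor: [y exp (- t y) <= 1 / t], a consequence of
    [1 + z <= exp z]. *)
Lemma wave_bounded a b (t : R) : 0 < t -> (forall j, Im (k j) = t * (j == e)%:R) ->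
  exists M, forall x, 0 <= x e 0 -> `|wave a b x| <= M.
Proof.
move=> t0 kt.
exists (`|Re a| + `|Im a| + (`|Re b| + `|Im b|) / t) => x x0.
have linE : lin (fun j => - Im (k j)) x = - (t * x e 0).
  rewrite /lin (bigD1 e) //= kt eqxx mulr1 big1 ?addr0 ?mulNr // => j /negPf je.
  by rewrite kt je mulr0 oppr0 mul0r.
rewrite /wave linE normrM (ger0_norm (expR_ge0 _)).
set E := expR _; set y := x e 0 in x0 E *.
have E0 : 0 <= E by exact: expR_ge0.
have E1 : E <= 1 by rewrite expR_le1 oppr_le0 mulr_ge0 // ltW.
have Ey : E * y <= t^-1.
  rewrite /E expRN -(ler_pM2l t0) mulfV ?gt_eqF // mulrCA ler_pdivrMl ?expR_gt0 // mulr1.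
  by apply: le_trans (expR_ge1Dx _); rewrite lerDr.
have ns (c u v : R) : `|c| <= 1 -> `|c * (u + y * v)| <= `|u| + y * `|v|.
  move=> c1; rewrite normrM; apply: le_trans (ler_piMl _ c1) _ => //.
  by apply: le_trans (ler_normD _ _) _; rewrite normrM (ger0_norm x0).
have cos1 z : `|@cos R z| <= 1 by rewrite ler_norml cos_geN1 cos_le1.
have sin1 z : `|@sin R z| <= 1 by rewrite ler_norml sin_geN1 sin_le1.
rewrite -mulrN.
have H : `|cos (lin (fun j => Re (k j)) x) * (Re a + y * - Im b) -
       sin (lin (fun j => Re (k j)) x) * (Im a + y * Re b)| <=
    (`|Re a| + `|Im a|) + y * (`|Re b| + `|Im b|).
  apply: le_trans (ler_normB _ _) _.
  have h1 := ns _ (Re a) (- Im b) (cos1 (lin (fun j => Re (k j)) x)).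
  have h2 := ns _ (Im a) (Re b) (sin1 (lin (fun j => Re (k j)) x)).
  by rewrite normrN in h1; apply: le_trans (lerD h1 h2) _; lra.
apply: le_trans (ler_wpM2l E0 H) _; rewrite mulrDr; apply: lerD.
  by apply: ler_piMl => //; exact: addr_ge0.
by rewrite mulrA [leRHS]mulrC; apply: ler_wpM2r => //; exact: addr_ge0.
Qed.

End Wave.

(** * The symbol and its normal derivative *)

Section QuadraticSymbol.
Variables (K : comRingType) (n m : nat) (B : 'I_n -> 'I_n -> 'M[K]_m) (e : 'I_n).

Definition symbol (k : 'I_n -> K) : 'M[K]_m :=
  \sum_(j < n) \sum_(l < n) (k j * k l) *: B j l.

(** The derivative of [symbol] in the direction [e], that is, the linear coefficient in
    [symbol_shift]. *)
Definition dsymbol (k : 'I_n -> K) : 'M[K]_m :=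
  \sum_(j < n) \sum_(l < n) (k j * (l == e)%:R + (j == e)%:R * k l) *: B j l.

Lemma symbol_delta : \sum_(j < n) \sum_(l < n) ((j == e)%:R * (l == e)%:R) *: B j l = B e e.
Proof.
rewrite (bigD1 e) //= (bigD1 e) //= !eqxx mulr1 scale1r.
rewrite big1 => [|l /negPf le]; last by rewrite le mulr0 scale0r.
rewrite addr0 big1 ?addr0 // => j /negPf je; rewrite big1 // => l _.
by rewrite je mul0r scale0r.
Qed.

Lemma symbol_shift (s : 'I_n -> K) (r : K) :
  symbol (fun j => s j + (j == e)%:R * r) = symbol s + r *: dsymbol s + r ^+ 2 *: B e e.
Proof.
rewrite -symbol_delta /symbol /dsymbol !scaler_sumr -!big_split; apply: eq_bigr => j _ /=.
rewrite !scaler_sumr -!big_split; apply: eq_bigr => l _ /=.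
by rewrite !scalerA -!scalerDl; congr (_ *: _); ring.
Qed.

Lemma dsymbol_shift (s : 'I_n -> K) (r : K) :
  dsymbol (fun j => s j + (j == e)%:R * r) = dsymbol s + (2 * r) *: B e e.
Proof.
rewrite -symbol_delta /dsymbol !scaler_sumr -!big_split; apply: eq_bigr => j _ /=.
rewrite !scaler_sumr -!big_split; apply: eq_bigr => l _ /=.
by rewrite !scalerA -!scalerDl; congr (_ *: _); ring.
Qed.

End QuadraticSymbol.

(** * Consequences of invariance for oscillating solutions *)

Section Necessity.
Variables (R : realType) (n m : nat) (Ac : 'I_n.+1 -> 'I_n.+1 -> 'M[R]_m.+1).
Variable alpha : 'I_m.+1 -> R.
Hypothesis inv : invariant_for (orthant alpha) (system_op Ac) half_space.
Local Notation C := R[i].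
Local Notation e := (@ord_max n).
Local Notation Re := (@complex.Re R).
Local Notation Im := (@complex.Im R).
Local Notation cx := (map_mx (real_complex R)).

Lemma partial_cst (V : normedModType R) (c : V) j :
  partial j (cst c : 'cV[R]_n.+1 -> V) = cst 0.
Proof. by apply/funext => x; exact: derive_cst. Qed.

Lemma C1_cst (V : normedModType R) (c : V) Omega : C1_on Omega (cst c : 'cV[R]_n.+1 -> V).
Proof.
have c0 (d : V) : continuous (cst d : 'cV[R]_n.+1 -> V) by exact: cst_continuous.
exact: (C1_onI (df := fun j => cst 0) (@c0 c) (fun j x => is_derive_cst c x _)
  (fun j => @c0 0)).
Qed.

Lemma C2_cst (V : normedModType R) (c : V) Omega : C2_on Omega (cst c : 'cV[R]_n.+1 -> V).
Proof. by split=> [|j]; [exact: C1_cst|rewrite partial_cst; exact: C1_cst]. Qed.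

(* The components other than [i] are made admissible by adding large constants. *)
Lemma invariant_ge0 (u : 'cV[R]_n.+1 -> 'cV[R]_m.+1) (M : R) i :
    C2_on half_space u -> continuous u ->
    (forall (x : 'cV[R]_n.+1) l, 0 <= x e 0 -> `|u x l 0| <= M) ->
    (forall x, half_space x -> system_op Ac u x = 0) ->
    (forall x : 'cV[R]_n.+1, x e 0 = 0 -> u x i 0 = 0) ->
  forall x, half_space x -> 0 <= u x i 0.
Proof.
move=> u2 cu bu uL ui x hx.
(* Component [i] is shifted by [alpha i] alone, so that membership in the orthant means
   nonnegativity of [u i]. *)
pose c : 'cV[R]_m.+1 := \col_l (alpha l + M * (l != i)%:R).
have M0 : 0 <= M by apply: le_trans (bu 0 i _); rewrite ?mxE.
have oH := @open_half_space R n.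
have c2 := C2_cst c half_space.
suff : orthant alpha ((u \+ cst c) x).
  by move=> /(_ i); rewrite !mxE eqxx mulr0 addr0 lerDr.
apply: (inv (C2_onD oH u2 c2) _ _ _ hx) => [|y hy|y].
- split.
    apply: continuous_subspaceT => y.
    by apply: continuousD; [exact: cu|exact: cst_continuous].
  rewrite closure_half_space /bounded_near; near=> K => y hy /=.
  apply: le_trans (ler_normD _ _) _.
  apply: (@le_trans _ _ (M + `|c|)); last by near: K; apply: nbhs_pinfty_ge; exact: num_real.
  by apply: lerD => //; apply: ler_norm_coord => // l; exact: bu.
- rewrite -[RHS](uL y hy); apply: eq_bigr => j _; apply: eq_bigr => k _.
  rewrite (partial2D _ _ oH u2 c2 hy) partial_cst.
  by rewrite [X in _ + X](_ : _ = 0) ?addr0 // partial_cst.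
- rewrite frontier_half_space => ye l; rewrite !mxE.
  have [->|li] := eqVneq l i; first by rewrite ui // add0r mulr0 addr0.
  have := bu y l; rewrite ye => /(_ (lexx _)).
  by rewrite ler_norml mulr1 => /andP[]; lra.
Unshelve. all: by end_near. Qed.

Definition csymbol (k : 'I_n.+1 -> C) : 'M[C]_m.+1 :=
  symbol (fun j l => cx (Ac j l)) k.

Definition cdsymbol (k : 'I_n.+1 -> C) : 'M[C]_m.+1 :=
  dsymbol (fun j l => cx (Ac j l)) e k.

Definition waves k (a b : 'cV[C]_m.+1) (x : 'cV[R]_n.+1) : 'cV[R]_m.+1 :=
  \col_l wave k e (a l 0) (b l 0) x.

Lemma waves_coord k a b l : (fun x => waves k a b x l 0) = wave k e (a l 0) (b l 0).
Proof. by apply/funext => x; rewrite mxE. Qed.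

Lemma C2_waves k a b Omega : open Omega -> C2_on Omega (waves k a b).
Proof. by move=> oO; apply: (C2_on_col oO) => l; rewrite waves_coord; exact: C2_wave. Qed.

Lemma continuous_waves k a b : continuous (waves k a b).
Proof.
by move=> x; apply: continuous_col => l; rewrite waves_coord; exact: continuous_wave.
Qed.

(** Two derivatives contribute [i ^ 2 = -1]. The image is again a wave, whose two coefficients are
    the negatives of the expressions assumed to vanish. *)
Lemma system_op_waves k a b x :
    csymbol k *m b = 0 -> csymbol k *m a + cdsymbol k *m b = 0 ->
  system_op Ac (waves k a b) x = 0.
Proof.
move=> eb ea.
have oT : open [set: 'cV[R]_n.+1] by exact: openT.
pose wa j l i := dwave_a k e j (dwave_a k e l (a i 0) (b i 0)) (dwave_b k l (b i 0)).
pose wb j l i := dwave_b k j (dwave_b k l (b i 0)).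
have i2 : 'i%C * 'i%C = -1 :> C by rewrite -expr2 sqr_i.
have waE j l i : wa j l i = - (k j * k l * a i 0 +
    (k j * (l == e)%:R + (j == e)%:R * k l) * b i 0).
  rewrite /wa /dwave_a /dwave_b.
  transitivity ('i%C * 'i%C * (k j * k l * a i 0 +
    (k j * (l == e)%:R + (j == e)%:R * k l) * b i 0)); first by ring.
  by rewrite i2 mulN1r.
have wbE j l i : wb j l i = - (k j * k l * b i 0).
  rewrite /wb /dwave_b.
  transitivity ('i%C * 'i%C * (k j * k l * b i 0)); first by ring.
  by rewrite i2 mulN1r.
apply/colP => p; rewrite [RHS]mxE.
transitivity (wave k e (\sum_(j < n.+1) \sum_(l < n.+1) \sum_(i < m.+1)
      (Ac j l p i)%:C%C * wa j l i) (\sum_(j < n.+1) \sum_(l < n.+1)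
      \sum_(i < m.+1) (Ac j l p i)%:C%C * wb j l i) x).
  rewrite /system_op summxE -wave_sum; apply: eq_bigr => j _.
  rewrite summxE -wave_sum; apply: eq_bigr => l _.
  rewrite mxE -wave_sum; apply: eq_bigr => i _.
  have [_ <- //] := C2_on_coord i oT (C2_waves k a b oT).
  by rewrite waves_coord !partial_wave waveZ.
have symE (f : 'I_n.+1 -> 'I_n.+1 -> C) (v : 'cV[C]_m.+1) :
    ((\sum_(j < n.+1) \sum_(l < n.+1) f j l *: cx (Ac j l)) *m v) p 0 =
    \sum_(j < n.+1) \sum_(l < n.+1) \sum_(i < m.+1) (Ac j l p i)%:C%C * (f j l * v i 0).
  rewrite mulmx_suml summxE; apply: eq_bigr => j _.
  rewrite mulmx_suml summxE; apply: eq_bigr => l _.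
  rewrite -scalemxAl !mxE mulr_sumr; apply: eq_bigr => i _; rewrite !mxE.
  by rewrite mulrCA.
have -> : \sum_(j < n.+1) \sum_(l < n.+1) \sum_(i < m.+1) (Ac j l p i)%:C%C * wa j l i =
    - (csymbol k *m a + cdsymbol k *m b) p 0.
  rewrite mxE /csymbol /cdsymbol /symbol /dsymbol !symE -big_split -sumrN; apply: eq_bigr => j _ /=.
  rewrite -big_split -sumrN; apply: eq_bigr => l _ /=.
  rewrite -big_split -sumrN; apply: eq_bigr => i _ /=.
  by rewrite waE mulrN mulrDr.
have -> : \sum_(j < n.+1) \sum_(l < n.+1) \sum_(i < m.+1) (Ac j l p i)%:C%C * wb j l i =
    - (csymbol k *m b) p 0.
  rewrite /csymbol /symbol symE -sumrN; apply: eq_bigr => j _.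
  rewrite -sumrN; apply: eq_bigr => l _; rewrite -sumrN; apply: eq_bigr => i _.
  by rewrite wbE mulrN.
by rewrite ea eb !mxE oppr0 wave0.
Qed.

Variable s : 'I_n.+1 -> R.

(** A complex shift of the normal frequency alone: decay away from the boundary, with a real
    tangential frequency. *)
Definition shift_freq (r : C) (j : 'I_n.+1) : C := (s j)%:C%C + (j == e)%:R * r.

Let Re_bool (c : bool) (r : C) : Re (c%:R * r) = c%:R * Re r.
Proof. by case: c; rewrite ?mul1r ?mul0r. Qed.

Let Im_bool (c : bool) (r : C) : Im (c%:R * r) = c%:R * Im r.
Proof. by case: c; rewrite ?mul1r ?mul0r. Qed.

(** The boundary phase does not depend on [r], which allows waves with different exponents to cancel
    there. *)
Lemma wave_boundary r a b (x : 'cV[R]_n.+1) : x e 0 = 0 ->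
  wave (shift_freq r) e a b x = cos (lin s x) * Re a - sin (lin s x) * Im a.
Proof.
move=> xe.
have linE (g h : 'I_n.+1 -> R) : (forall j, j != e -> h j = g j) -> lin h x = lin g x.
  move=> hg; rewrite /lin (bigD1 e) // [RHS](bigD1 e) //= xe !mulr0; congr (_ + _).
  by apply: eq_bigr => j /hg ->.
rewrite /wave xe !mul0r subr0 addr0.
rewrite (linE (fun=> 0) (fun j => - Im (shift_freq r j))); last first.
  by move=> j /negPf je; rewrite raddfD /= Im_bool je mul0r addr0 oppr0.
rewrite (linE s (fun j => Re (shift_freq r j))); last first.
  by move=> j /negPf je; rewrite raddfD /= Re_bool je mul0r addr0.
rewrite [lin (fun=> 0) x]big1 => [|j _]; last by rewrite mul0r.
by rewrite expR0 mul1r.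
Qed.

Definition wave_pair r (a b : 'cV[C]_m.+1) :=
  csymbol (shift_freq r) *m b = 0 /\
  csymbol (shift_freq r) *m a + cdsymbol (shift_freq r) *m b = 0.

Lemma wave_pairN r a b : wave_pair r a b -> wave_pair r (- a) (- b).
Proof. by case=> eb ea; split; rewrite ?mulmxN ?eb ?oppr0 // -opprD ea oppr0. Qed.

Lemma two_waves_ge0 r1 r2 a1 b1 a2 b2 i : 0 < Im r1 -> 0 < Im r2 ->
    wave_pair r1 a1 b1 -> wave_pair r2 a2 b2 -> a1 i 0 + a2 i 0 = 0 ->
  forall x, half_space x ->
    0 <= wave (shift_freq r1) e (a1 i 0) (b1 i 0) x +
         wave (shift_freq r2) e (a2 i 0) (b2 i 0) x.
Proof.
move=> r1p r2p [eb1 ea1] [eb2 ea2] ai x hx.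
have oH := @open_half_space R n.
have Im_freq r j : Im (shift_freq r j) = Im r * (j == e)%:R.
  by rewrite raddfD /= Im_bool add0r mulrC.
have bd r (a b : 'cV[C]_m.+1) : 0 < Im r -> exists M, forall l (x : 'cV[R]_n.+1),
    0 <= x e 0 -> `|wave (shift_freq r) e (a l 0) (b l 0) x| <= M.
  move=> rp; have ex l := wave_bounded (a l 0) (b l 0) rp (Im_freq r).
  have [M MP] := choice ex.
  exists (\sum_l `|M l|) => l y y0; apply: le_trans (MP l y y0) _.
  by rewrite (bigD1 l) //=; apply: le_trans (ler_norm _) _; rewrite lerDl sumr_ge0.
have [M1 M1P] := bd r1 a1 b1 r1p; have [M2 M2P] := bd r2 a2 b2 r2p.
pose u := waves (shift_freq r1) a1 b1 \+ waves (shift_freq r2) a2 b2.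
have c21 := C2_waves (shift_freq r1) a1 b1 oH.
have c22 := C2_waves (shift_freq r2) a2 b2 oH.
have u2 : C2_on half_space u by exact: C2_onD.
have uE y l : u y l 0 = wave (shift_freq r1) e (a1 l 0) (b1 l 0) y +
                        wave (shift_freq r2) e (a2 l 0) (b2 l 0) y by rewrite !mxE.
rewrite -uE; apply: (invariant_ge0 (M := M1 + M2) u2) hx => [y|y l y0|y hy|y ye].
- exact: continuousD (@continuous_waves _ a1 b1 y) (@continuous_waves _ a2 b2 y).
- by rewrite uE; apply: le_trans (ler_normD _ _) _; apply: lerD; [exact: M1P|exact: M2P].
- transitivity (system_op Ac (waves (shift_freq r1) a1 b1) y +
                system_op Ac (waves (shift_freq r2) a2 b2) y).
    rewrite /system_op -big_split; apply: eq_bigr => j _ /=.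
    rewrite -big_split; apply: eq_bigr => l _ /=; rewrite -mulmxDr.
    by rewrite (partial2D _ _ oH c21 c22 hy).
  by rewrite !system_op_waves ?addr0.
- rewrite uE !wave_boundary // addrACA -opprD -!mulrDr.
  have -> : Re (a1 i 0) + Re (a2 i 0) = 0 by rewrite -raddfD ai.
  have -> : Im (a1 i 0) + Im (a2 i 0) = 0 by rewrite -raddfD ai.
  by rewrite !mulr0 subrr.
Qed.

(* The [i]-th component vanishes identically, hence so does its normal derivative;
   its boundary values are [Re (exp (i s.x) i z)] with [s.x] arbitrary. *)
Lemma two_waves_rigid r1 r2 a1 b1 a2 b2 i : (exists2 j, j != e & s j != 0) ->
    0 < Im r1 -> 0 < Im r2 ->
    wave_pair r1 a1 b1 -> wave_pair r2 a2 b2 -> a1 i 0 + a2 i 0 = 0 ->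
  r1 * a1 i 0 + b1 i 0 + (r2 * a2 i 0 + b2 i 0) = 0.
Proof.
move=> [j0 j0e sj0] r1p r2p w1 w2 ai.
have oH := @open_half_space R n.
pose f := wave (shift_freq r1) e (a1 i 0) (b1 i 0) \+
          wave (shift_freq r2) e (a2 i 0) (b2 i 0).
have f0 x : half_space x -> f x = 0.
  move=> hx; apply/eqP; rewrite eq_le (two_waves_ge0 r1p r2p w1 w2 ai hx) andbT.
  have := two_waves_ge0 (i := i) r1p r2p (wave_pairN w1) (wave_pairN w2).
  rewrite !mxE -opprD ai oppr0 => /(_ erefl x hx).
  have N (k : 'I_n.+1 -> C) a b : wave k e (- a) (- b) x = - wave k e a b x.
    by rewrite -[RHS]mulN1r waveZ rmorphN1 !mulN1r.
  by rewrite !N -opprD oppr_ge0.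
have c1 := @C1_wave _ _ (shift_freq r1) e (a1 i 0) (b1 i 0) half_space.
have c2 := @C1_wave _ _ (shift_freq r2) e (a2 i 0) (b2 i 0) half_space.
pose g := wave (shift_freq r1) e (dwave_a (shift_freq r1) e e (a1 i 0) (b1 i 0))
            (dwave_b (shift_freq r1) e (b1 i 0)) \+
          wave (shift_freq r2) e (dwave_a (shift_freq r2) e e (a2 i 0) (b2 i 0))
            (dwave_b (shift_freq r2) e (b2 i 0)).
have g0 x : half_space x -> g x = 0.
  move=> hx; have <- : partial e f x = g x by rewrite (partialD e c1 c2 hx) !partial_wave.
  by rewrite (eq_partial e oH (g := cst 0) f0 hx) partial_cst.
have gc : continuous g.
  by move=> x; apply: continuousD; exact: continuous_wave.
have g0b (x : 'cV[R]_n.+1) : x e 0 = 0 -> g x = 0.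
  move=> xe; have cl : closed (g @^-1` [set 0]).
    by apply: closed_comp => [y _|]; [exact: gc|exact: closed_eq].
  have : closure half_space x by rewrite closure_half_space /= xe.
  by move/(closureS (g0 : half_space `<=` g @^-1` [set 0])); rewrite -(iffLR (closure_id _) cl).
set z := (X in X = 0).
have gE (x : 'cV[R]_n.+1) : x e 0 = 0 ->
    cos (lin s x) * Re ('i%C * z) - sin (lin s x) * Im ('i%C * z) = 0.
  move=> xe; transitivity (g x); last exact: g0b.
  rewrite /g /= !wave_boundary //.
  have -> : 'i%C * z = dwave_a (shift_freq r1) e e (a1 i 0) (b1 i 0) +
      dwave_a (shift_freq r2) e e (a2 i 0) (b2 i 0).
    rewrite /dwave_a /z /shift_freq eqxx !mul1r -mulrDr; congr (_ * _).
    transitivity ((s e)%:C%C * (a1 i 0 + a2 i 0) +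
      (r1 * a1 i 0 + b1 i 0 + (r2 * a2 i 0 + b2 i 0))); last by ring.
    by rewrite ai mulr0 add0r.
  by rewrite !raddfD /=; ring.
(* The boundary points with phase [0] and [pi / 2] isolate the real and the imaginary part; the
   second lies on the tangential axis [j0]. *)
have R0 : Re ('i%C * z) = 0.
  have := gE 0; rewrite mxE => /(_ erefl).
  by rewrite /lin big1 ?cos0 ?sin0 ?mul1r ?mul0r ?subr0 // => j _; rewrite mxE mulr0.
have I0 : Im ('i%C * z) = 0.
  have := gE ((pi / 2 / s j0) *: delta_mx j0 0).
  rewrite !mxE eq_sym (negPf j0e) mulr0 => /(_ erefl).
  have -> : lin s ((pi / 2 / s j0) *: delta_mx j0 0) = pi / 2.
    rewrite /lin (bigD1 j0) //= !mxE !eqxx mulr1 big1 ?addr0.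
      by rewrite mulrC divfK.
    by move=> j /negPf jj; rewrite !mxE jj mulr0 mulr0.
  by rewrite cos_pihalf sin_pihalf mul0r mul1r sub0r => /eqP; rewrite oppr_eq0 => /eqP.
have : 'i%C * z = 0 by case: ('i%C * z) R0 I0 => ? ? /= -> ->.
by move/eqP; rewrite mulf_eq0 => /orP[/eqP[/eqP]|/eqP//]; rewrite oner_eq0.
Qed.

End Necessity.

(** * Invertibility of strongly elliptic symbols *)

Section StrongEllipticity.
Variables (R : realType).

Lemma inner_ge0 n (x : 'cV[R]_n) : 0 <= inner x x.
Proof. by apply: sumr_ge0 => i _; rewrite -expr2 sqr_ge0. Qed.

Lemma inner_gt0 n (x : 'cV[R]_n) : x != 0 -> 0 < inner x x.
Proof.
move=> x0; rewrite lt_neqAle inner_ge0 andbT eq_sym; apply: contra_neq x0 => xx.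
apply/colP => i; rewrite mxE; apply/eqP; rewrite -sqrf_eq0; apply/eqP.
have sq j : true -> 0 <= x j 0 * x j 0 by rewrite -expr2 sqr_ge0.
by have := psumr_eq0P sq xx isT (i := i); rewrite expr2.
Qed.

(** A nonzero vector killed by the symbol would make the coercive form vanish. *)
Lemma strongly_elliptic_unit n m (Ac : 'I_n -> 'I_n -> 'M[R]_m) (s : 'I_n -> R) :
  strongly_elliptic Ac -> (exists j, s j != 0) -> symbol Ac s \in unitmx.
Proof.
move=> [d d0 ell] [j sj].
pose x : 'cV[R]_n := \col_j s j.
have x0 : x != 0 by apply: contra_neq sj => /colP/(_ j); rewrite !mxE.
have symE : symbol Ac s = \sum_(j < n) \sum_(l < n) (x j 0 * x l 0) *: Ac j l.
  by apply: eq_bigr => p _; apply: eq_bigr => q _; rewrite !mxE.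
rewrite -unitmx_tr -row_free_unit; apply: inj_row_free => v v0.
apply/eqP/negPn/negP => nv.
have z0 : v^T != 0 by apply: contra_neq nv => vT0; rewrite -[v]trmxK vT0 trmx0.
have := ell x v^T; rewrite -symE -[symbol Ac s *m _]trmxK trmx_mul trmxK v0 trmx0.
rewrite [inner 0 _]big1 => [|i _]; last by rewrite mxE mul0r.
by rewrite !sqr_sqrtr ?inner_ge0 // leNgt !mulr_gt0 ?inner_gt0.
Qed.

End StrongEllipticity.

(** * Simultaneous diagonalization of the coefficients *)

Section Diagonalization.
Variables (R : realType) (n m : nat) (Ac : 'I_n.+1 -> 'I_n.+1 -> 'M[R]_m.+1).
Variable alpha : 'I_m.+1 -> R.
Hypothesis Ac_sym : forall j k, Ac j k = Ac k j.
Hypothesis Ac_ell : strongly_elliptic Ac.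
Hypothesis inv : invariant_for (orthant alpha) (system_op Ac) half_space.
Local Notation C := R[i].
Local Notation e := (@ord_max n).
Local Notation cx := (map_mx (real_complex R)).
Local Notation T := (Ac e e).

Let T_unit : T \in unitmx.
Proof.
rewrite -(symbol_delta Ac e).
apply: (strongly_elliptic_unit (s := fun j => (j == e)%:R) Ac_ell).
by exists e; rewrite eqxx oner_neq0.
Qed.

Let cx_symbol (s : 'I_n.+1 -> R) :
  cx (symbol Ac s) = symbol (fun j l => cx (Ac j l)) (fun j => (s j)%:C%C).
Proof.
rewrite /symbol raddf_sum; apply: eq_bigr => j _.
by rewrite raddf_sum; apply: eq_bigr => l _; rewrite /= map_mxZ rmorphM.
Qed.

Let cx_dsymbol (s : 'I_n.+1 -> R) :
  cx (dsymbol Ac e s) = dsymbol (fun j l => cx (Ac j l)) e (fun j => (s j)%:C%C).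
Proof.
rewrite /dsymbol raddf_sum; apply: eq_bigr => j _.
rewrite raddf_sum; apply: eq_bigr => l _; rewrite /= map_mxZ.
by rewrite rmorphD !rmorphM !rmorph_nat.
Qed.

(** [pencil_diagonal] is applied to the normalized symbol as a polynomial in the normal frequency,
    the rigidity of waves supplying its hypothesis. *)
Lemma symbol_offdiag (s : 'I_n.+1 -> R) p q :
  p != q -> (invmx T *m symbol Ac s) p q = 0.
Proof.
move=> pq.
(* Without a tangential frequency the boundary phase cannot vary, but the symbol is then a multiple
   of [T]. *)
have [[j0 j0e sj0]|/forall2NP par] := pselect (exists2 j, j != e & s j != 0); last first.
  have -> : s = (fun j => 0 + (j == e)%:R * s e).
    apply/funext => j; rewrite add0r; have [->|je] := eqVneq j e; first by rewrite mul1r.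
    by rewrite mul0r; have [/negP//|/negP/negPn/eqP] := par j.
  rewrite symbol_shift.
  have -> : symbol Ac (fun=> 0) = 0.
    by apply: big1 => j _; apply: big1 => l _; rewrite mul0r scale0r.
  have -> : dsymbol Ac e (fun=> 0) = 0.
    by apply: big1 => j _; apply: big1 => l _; rewrite mul0r mulr0 addr0 scale0r.
  by rewrite scaler0 !add0r -scalemxAr mulVmx // !mxE (negPf pq) mulr0.
have rev3 (V : zmodType) (x y z : V) : x + y + z = z + y + x.
  by rewrite addrC [x + y]addrC addrA.
(* The transposes match the row convention of the pencil; the existential keeps [P] and [Q]
   opaque. *)
have [P PE] : exists P, P = (invmx T *m symbol Ac s)^T by eexists.
have [Q QE] : exists Q, Q = (invmx T *m dsymbol Ac e s)^T by eexists.
have TP : T *m P^T = symbol Ac s by rewrite PE trmxK mulKVmx.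
have TQ : T *m Q^T = dsymbol Ac e s by rewrite QE trmxK mulKVmx.
have pencilE r : cx T *m (pencil P Q r)^T = csymbol Ac (shift_freq s r).
  rewrite [RHS](symbol_shift (fun j l => cx (Ac j l)) e (fun j => (s j)%:C%C) r).
  rewrite -cx_symbol -cx_dsymbol -TP -TQ !map_mxM -!map_trmx.
  have -> : (pencil P Q r)^T = (r ^+ 2)%:M + r *: (cx Q)^T + (cx P)^T.
    by apply/matrixP => x y; rewrite !mxE eq_sym.
  by rewrite !mulmxDr -scalemxAr mul_mx_scalar; exact: rev3.
have dpencilE r : cx T *m ((2 * r)%:M + cx Q)^T = cdsymbol Ac (shift_freq s r).
  rewrite [RHS](dsymbol_shift (fun j l => cx (Ac j l)) e (fun j => (s j)%:C%C) r).
  rewrite -cx_dsymbol -TQ map_mxM -map_trmx.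
  have -> : ((2 * r)%:M + cx Q)^T = (2 * r)%:M + (cx Q)^T.
    by apply/matrixP => x y; rewrite !mxE eq_sym.
  by rewrite mulmxDr mul_mx_scalar addrC.
have pairE r a b : jordan_pair P Q r a b -> wave_pair Ac s r a^T b^T.
  case=> eb ea; rewrite /wave_pair -pencilE -dpencilE -!mulmxA -!trmx_mul eb.
  by rewrite -mulmxDr -linearD /= ea !trmx0 !mulmx0.
(* A real normal shift leaves the nonzero tangential entry [s j0] in place, so strong ellipticity
   applies at every [t]. *)
have reg t : (t ^+ 2)%:M + t *: Q + P \in unitmx.
  have -> : (t ^+ 2)%:M + t *: Q + P =
      (invmx T *m symbol Ac (fun j => s j + (j == e)%:R * t))^T.
    rewrite symbol_shift !mulmxDr -!scalemxAr mulVmx // !linearD /= !linearZ /= trmx1.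
    by rewrite scalemx1 -PE -QE; exact: rev3.
  rewrite unitmx_tr unitmx_mul unitmx_inv T_unit /=.
  apply: strongly_elliptic_unit => //; exists j0.
  by rewrite (negPf j0e) mul0r addr0.
have qp : q != p by rewrite eq_sym.
have [|+ _] := pencil_diagonal reg _ qp; last by rewrite PE mxE.
move=> r1 r2 a1 b1 a2 b2 r1p r2p /pairE w1 /pairE w2 i ai.
have := two_waves_rigid inv (i := i) (ex_intro2 _ _ j0 j0e sj0) r1p r2p w1 w2.
by rewrite !mxE; apply.
Qed.

(** Polarization by way of [psd_diag0]: a symmetric form that vanishes identically is semidefinite
    with zero diagonal, so all its entries are [0]. *)
Lemma coef_offdiag j k p q : p != q -> (invmx T *m Ac j k) p q = 0.
Proof.
move=> pq; pose B j k := (invmx T *m Ac j k) p q.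
have qB s : quad B s = 0.
  rewrite -(symbol_offdiag s pq) /symbol mulmx_sumr summxE; apply: eq_bigr => l _.
  rewrite mulmx_sumr summxE; apply: eq_bigr => l' _.
  by rewrite -scalemxAr mxE /B; ring.
have Bsym l l' : B l l' = B l' l by rewrite /B Ac_sym.
apply: (@psd_diag0 _ _ B) => // [s|]; first by rewrite qB.
have := quad_sub (fun=> 0) j (-1) Bsym; rewrite !qB.
by rewrite big1 => [|l _]; rewrite ?mul0r // mulr0 subrr add0r sqrrN expr1n mul1r.
Qed.

Let a i j k := (invmx T *m Ac j k) i i.

Lemma coef_diagonal j k : Ac j k = T *m diag_mx (\row_i a i j k).
Proof.
rewrite -[LHS](mulKVmx T_unit); congr (_ *m _); apply/matrixP => p q.
rewrite [RHS]mxE [X in _ = X *+ _]mxE; have [<-|pq] := eqVneq p q; first by rewrite mulr1n.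
by rewrite coef_offdiag // mulr0n.
Qed.

(** The scalar symbol is a diagonal entry of the normalized symbol, which is diagonal and
    invertible; a zero there would give a zero row. *)
Lemma elliptic_diag i : elliptic (a i).
Proof.
move=> x x0; set D := invmx T *m symbol Ac (fun j => x j 0).
have Du : D \in unitmx.
  rewrite unitmx_mul unitmx_inv T_unit; apply: strongly_elliptic_unit => //.
  have [//|/forallNP no] := pselect (exists j, x j 0 != 0).
  by case/eqP: x0; apply/colP => j; rewrite mxE; have /negP/negPn/eqP := no j.
have -> : \sum_(j < n.+1) \sum_(k < n.+1) a i j k * x j 0 * x k 0 = D i i.
  rewrite /D /symbol mulmx_sumr summxE; apply: eq_bigr => j _.
  rewrite mulmx_sumr summxE; apply: eq_bigr => k _.
  by rewrite -scalemxAr [RHS]mxE -mulrA mulrC.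
apply/eqP => Dii; have : row i D = 0.
  apply/rowP => q; rewrite [LHS]mxE [RHS]mxE; have [<-|iq] := eqVneq i q; first exact: Dii.
  exact: symbol_offdiag.
rewrite rowE => /(congr1 (mulmx^~ (invmx D))); rewrite mulmxK // mul0mx.
by move/rowP/(_ i); rewrite !mxE !eqxx => /eqP; rewrite oner_eq0.
Qed.

(** The matrix [A] is the coefficient [T] of the second normal derivative, invertible by strong
    ellipticity. *)
Lemma invariant_diagonal : exists (A : 'M[R]_m.+1) (a : 'I_m.+1 -> 'I_n.+1 -> 'I_n.+1 -> R),
  [/\ A \in unitmx, forall i, elliptic (a i), strongly_elliptic (mul_diag_coef A a) &
      eq_op_C2 (system_op Ac) (fun u x => A *m diag_op a u x)].
Proof.
exists T, a; split=> //; first exact: elliptic_diag.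
  suff -> : mul_diag_coef T a = Ac by [].
  by apply/funext => j; apply/funext => k; rewrite [RHS]coef_diagonal.
by move=> u u2 x; exact: (system_op_diag coef_diagonal openT u2 I).
Qed.

End Diagonalization.

Unset Implicit Arguments.

Theorem theorem3 (R : realType) (n m : nat)
    (Ac : 'I_n.+1 -> 'I_n.+1 -> 'M[R]_m.+1)
    (Ac_sym : forall j k, Ac j k = Ac k j)
    (Ac_ell : strongly_elliptic Ac)
    (alpha : 'I_m.+1 -> R) :
  invariant_for (orthant alpha) (system_op Ac) half_space <->
  exists (A : 'M[R]_m.+1) (a : 'I_m.+1 -> 'I_n.+1 -> 'I_n.+1 -> R),
    [/\ A \in unitmx,
        forall i, elliptic (a i),
        strongly_elliptic (mul_diag_coef A a) &
        eq_op_C2 (system_op Ac) (fun u x => A *m diag_op a u x)].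
Proof.
split=> [inv|[A [a [Au a_ell _ AcE]]]]; first exact: invariant_diagonal inv.
exact: orthant_invariant Ac_sym AcE alpha Au a_ell.
Qed.
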